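(* Let $r\ge3$, $V=\mathbb{F}_{q^n}^r$, and let $U,W$ be $\mathbb{F}_q$-subspaces of $V$ with $\dim_{\mathbb{F}_q}U=\dim_{\mathbb{F}_q}W=(r-1)n$ and $L_U=L_W$ in $\mathrm{PG}(r-1,q^n)$. Let $\ell=\mathrm{PG}(T,q^n)$ be a line, $T$ a $2$-dimensional $\mathbb{F}_{q^n}$-subspace of $V$, and put $U_0=U\cap T$, $W_0=W\cap T$. Suppose $\dim_{\mathbb{F}_q}U_0=\dim_{\mathbb{F}_q}W_0=n$ and that $L_{U_0}=L_{W_0}$ is a linear set of pseudoregulus type with maximum field of linearity $\mathbb{F}_q$. Then either $W=\lambda U$ for some $\lambda\in\mathbb{F}_{q^n}^*$, or $L_U=L_W$ is a cone with vertex a codimension-$2$ projective subspace of $\mathrm{PG}(r-1,q^n)$ disjoint from $\ell$ and base $L_{U_0}=L_{W_0}$.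
   Context: $L_X=\{\langle u\rangle_{\mathbb{F}_{q^n}}:u\in X\setminus\{0\}\}$. A linear set $L_{U_0}$ of a line $\ell\cong\mathrm{PG}(1,q^n)$ with $\dim_{\mathbb{F}_q}U_0=n$ is of pseudoregulus type if $U_0=\{\mu v_0+\mu^{q^i}v_1:\mu\in\mathbb{F}_{q^n}\}$ for some $i$ and $\mathbb{F}_{q^n}$-independent $v_0,v_1\in T$. The maximum field of linearity of $L$ is $\mathbb{F}_{q^e}$ with $e\mid n$ largest such that $L=L_{X}$ for some $\mathbb{F}_{q^e}$-subspace $X$. A cone with vertex a subspace $\Lambda$ and base a set $\mathcal B\subseteq\ell$ (with $\Lambda\cap\ell=\emptyset$) is the union of the subspaces $\langle\Lambda,P\rangle$, $P\in\mathcal B$. *)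

(* Defs.v *)
From HB Require Import structures.
From mathcomp Require Import all_boot all_order all_algebra all_field.
Set Implicit Arguments. Unset Strict Implicit. Unset Printing Implicit Defensive.
Import GRing.Theory.
Local Open Scope ring_scope.

(* F = F_q (finite field), L = F_{q^n} given as a finite-dimensional field
   extension of F, so n = \dim {:L}.  The ambient space V = F_{q^n}^r is
   {ffun 'I_r -> L}, which is canonically an F-vector space (vectType F),
   so F_q-subspaces are {vspace (Vr L r)} and \dim is the F_q-dimension. *)

Definition Vr (F : finFieldType) (L : fieldExtType F) (r : nat) :=
  {ffun 'I_r -> L}.

Section Defs.
Variables (F : finFieldType) (L : fieldExtType F) (r : nat).
Local Notation V := (Vr L r).

Definition Lscale (a : L) (v : V) : V := [ffun i => a * v i].

Definition Lcomb (k : nat) (c : 'I_k -> L) (b : 'I_k -> V) : V :=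
  \sum_(i < k) Lscale (c i) (b i).

Definition Lindep (k : nat) (b : 'I_k -> V) : Prop :=
  forall c : 'I_k -> L, Lcomb c b = 0 -> forall i, c i = 0.

Definition LsubspaceDim (T : {vspace V}) (k : nat) : Prop :=
  exists b : 'I_k -> V, Lindep b /\
    forall v, v \in T <-> exists c : 'I_k -> L, v = Lcomb c b.

(* The F_q-linear set L_X, as the set of (nonzero) vectors representing its
   points: <v>_{F_{q^n}} is in L_X iff v <> 0 and some nonzero F_{q^n}-multiple
   of v lies in X. *)
Definition LinSet (X : V -> Prop) (v : V) : Prop :=
  v <> 0 /\ exists l : L, l != 0 /\ X (Lscale l v).

Definition inVS (X : {vspace V}) : V -> Prop := fun v => v \in X.

Definition PSetEq (P Q : V -> Prop) : Prop := forall v, P v <-> Q v.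

Definition pseudoregulusType (T : {vspace V}) (P : V -> Prop) : Prop :=
  exists (i : nat) (v0 v1 : V),
    v0 \in T /\ v1 \in T /\ Lindep [ffun j : 'I_2 => if j == ord0 then v0 else v1] /\
    PSetEq P (LinSet (fun x => exists mu : L,
                 x = Lscale mu v0 + Lscale (mu ^+ (#|F| ^ i)) v1)).

Definition maxFieldLinearity_q (P : V -> Prop) : Prop :=
  forall (K : {subfield L}) (X : {vspace V}),
    (1 < \dim K)%N ->
    (forall k v, k \in K -> v \in X -> Lscale k v \in X) ->
    ~ PSetEq P (LinSet (inVS X)).

Definition Cone (Lam : {vspace V}) (B : V -> Prop) (v : V) : Prop :=
  v <> 0 /\ exists (p w : V) (l : L), B p /\ w \in Lam /\ v = w + Lscale l p.

End Defs.

(* Main.v *)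
Require Import Defs.
From HB Require Import structures.
From mathcomp Require Import all_boot all_order all_algebra all_field.
From mathcomp Require Import all_fingroup all_solvable zify.
Import GRing.Theory FinRing.Theory.
Set Implicit Arguments. Unset Strict Implicit. Unset Printing Implicit Defensive.

(* Write points as (x, y, z) with respect to v0, v1 and a complement of T. As
   <v1> is not in L_U = L_W, both U and W are graphs y = f(x, z), where f is a
   sum of linearized polynomials in the coordinates, and L_U = L_W says that on
   every line through <v1> the two linearized polynomials G, H obtained by
   restriction take the same set of slopes G(t)/t, H(t)/t. A slope is attained
   q^w - 1 = -1 times modulo the characteristic, so all power sums of the slopes
   agree; for the exponents sum_{s in S} Q^s with S a proper subset of Z/n, they
   are, up to sign, the permanents of the principal S-submatrices of the Dickson
   matrices. Comparing them along chordless cycles of the circulant graph spanned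
   by the support shows that f(x, 0) is a monomial alpha x^{Q} with Q = q^e,
   gcd(e, n) = 1 (Payne's theorem on translation ovals for q = 2), and on the lines
   with x = s t, z = t z0 the permanents become polynomials in s whose coefficients
   on the cycles 0 -> c -> c + 1 -> ... -> n = 0 isolate the c-th coefficient of
   f(0, t z0). If all these coefficients with c > 1 vanish, then U is a cone;
   otherwise they force, after rescaling W, that W = U. *)

(** * Base-q digits and cyclic carries modulo q^n - 1 *)

Section Digits.
Variable q : nat.
Hypothesis q_gt1 : 1 < q.

Lemma digits_lt n (c : nat -> nat) :
  (forall t, t < n -> c t < q) -> \sum_(t < n) c t * q ^ t < q ^ n.
Proof.
elim: n => [|n IHn] Hc; first by rewrite big_ord0.
rewrite big_ord_recr /= expnS.
have Hn := Hc n (ltnSn n); have H := IHn (fun t Ht => Hc t (ltnW Ht)).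
have Hm : (c n).+1 * q ^ n <= q * q ^ n by rewrite leq_mul2r Hn orbT.
by apply: leq_trans Hm; rewrite mulSn ltn_add2r.
Qed.

Lemma digits_inj n (c e : nat -> nat) :
  (forall t, t < n -> c t < q) -> (forall t, t < n -> e t < q) ->
  \sum_(t < n) c t * q ^ t = \sum_(t < n) e t * q ^ t ->
  forall t, t < n -> c t = e t.
Proof.
elim: n => [//|n IHn] Hc He.
rewrite !big_ord_recr /= => E.
have lc := digits_lt (fun t Ht => Hc t (ltnW Ht)).
have le := digits_lt (fun t Ht => He t (ltnW Ht)).
have q_n : 0 < q ^ n by rewrite expn_gt0 (ltnW q_gt1).
have top : c n = e n.
  have := congr1 (divn^~ (q ^ n)) E.
  by rewrite /= !divnDMl // !divn_small.
move=> t; rewrite ltnS leq_eqVlt => /orP[/eqP->//|].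
apply: IHn => [u Hu|u Hu|]; [exact: Hc (ltnW Hu)|exact: He (ltnW Hu)|].
by move/eqP: E; rewrite top eqn_add2r => /eqP.
Qed.

Lemma expn_mod_pred n t : 0 < n -> q ^ t = q ^ (t %% n) %[mod (q ^ n).-1].
Proof.
move=> n_gt0; have H1 : q ^ n = 1 %[mod (q ^ n).-1].
  have q_n : 0 < q ^ n by rewrite expn_gt0 (ltnW q_gt1).
  by rewrite -{1}(prednK q_n) -addn1 modnDl.
by rewrite {1}(divn_eq t n) expnD mulnC mulnC expnM [(q ^ _) ^ n]expnAC
  -modnMml -modnXm H1 modnXm exp1n modnMml mul1n.
Qed.

(* Replacing q units at position t by one unit at position t + 1 (cyclically)
   keeps the value modulo q ^ n - 1 and lowers the weight. *)
Lemma cyclic_digits_inj n (c e : nat -> nat) :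
  0 < n -> (forall t, t < n -> e t <= 1) -> (exists2 t, t < n & e t = 0) ->
  \sum_(t < n) c t <= \sum_(t < n) e t ->
  \sum_(t < n) c t * q ^ t = \sum_(t < n) e t * q ^ t %[mod (q ^ n).-1] ->
  forall t, t < n -> c t = e t.
Proof.
move=> n_gt0 He [t0 Ht0 e0].
have He' t : t < n -> e t < q.
  by move=> Ht; exact: leq_ltn_trans (He _ Ht) q_gt1.
have elt : \sum_(t < n) e t * q ^ t < (q ^ n).-1.
  (* Filling the empty position [t0] still gives a number below q^n, so the value of [e] is at most
     q^n - 1 - q^t0 and is already reduced modulo q^n - 1. *)
  pose e' t := if t == t0 then 1 else e t.
  have : \sum_(t < n) e' t * q ^ t < q ^ n.
    by apply: digits_lt => t Ht; rewrite /e'; case: eqP => // _; exact: He'.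
  rewrite (bigD1 (Ordinal Ht0)) //= [in X in _ -> X](bigD1 (Ordinal Ht0)) //=.
  rewrite e0 /e' eqxx mul0n add0n mul1n.
  rewrite (eq_bigr (fun t : 'I_n => e t * q ^ t)); last first.
    by move=> t /eqP Ht; case: eqP => // E; case: Ht; apply: val_inj.
  have : 0 < q ^ t0 by rewrite expn_gt0 (ltnW q_gt1).
  lia.
move: {2}(\sum_(t < n) c t).+1 (ltnSn (\sum_(t < n) c t)) => N.
elim: N c => [//|N IHN] c HN Hw Hmod.
have [/forallP cq|] := boolP [forall t : 'I_n, c t < q].
  have Hc t : t < n -> c t < q by move=> Ht; exact: (cq (Ordinal Ht)).
  have clt := digits_lt Hc.
  apply: digits_inj => //.
  move: Hmod; rewrite [RHS]modn_small //.
  case: (ltnP (\sum_(t < n) c t * q ^ t) (q ^ n).-1) => Hlt.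
    by rewrite modn_small.
  have Ec : \sum_(t < n) c t * q ^ t = (q ^ n).-1 by lia.
  rewrite {1}Ec modnn => /esym Ee; rewrite Ee.
  move/eqP: Ee; rewrite sum_nat_eq0 => /forallP z.
  have ez : \sum_(t < n) e t = 0.
    rewrite big1 // => t _; move: (z t) => /=.
    by rewrite muln_eq0 expn_eq0 (gtn_eqF (ltnW q_gt1)) orbF => /eqP.
  rewrite big1 // => t _; move: Hw; rewrite ez leqn0 sum_nat_eq0.
  by move=> /forallP/(_ t)/eqP->.
rewrite negb_forall => /existsP[t1]; rewrite -leqNgt => Hq.
pose t2 := Ordinal (ltn_pmod t1.+1 n_gt0).
pose c' t := c t - q * (t == t1 :> nat) + (t == t2 :> nat).
have c'E t : c' t + q * (t == t1 :> nat) = c t + (t == t2 :> nat).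
  rewrite /c' addnAC subnK //; case: eqP => [->|]; by rewrite ?muln1 ?muln0.
have s1 (u : 'I_n) (f : nat -> nat) :
    \sum_(t < n) (t == u :> nat) * f t = f u.
  rewrite (bigD1 u) //= eqxx mul1n big1 ?addn0 // => t /negPf.
  by rewrite -val_eqE /= => ->.
have w : \sum_(t < n) c' t + q = \sum_(t < n) c t + 1.
  have := s1 t1 (fun=> q); have := s1 t2 (fun=> 1) => <- E2.
  rewrite -[X in _ + X]E2.
  rewrite -!big_split /=; apply: eq_bigr => t _.
  by rewrite muln1 -c'E mulnC.
have v : \sum_(t < n) c' t * q ^ t + q ^ t1.+1
       = \sum_(t < n) c t * q ^ t + q ^ t2.
  have := s1 t1 (fun t => q ^ t.+1); have := s1 t2 (fun t => q ^ t) => <- <-.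
  rewrite -!big_split /=; apply: eq_bigr => t _.
  by rewrite -mulnDl -c'E mulnDl expnS mulnCA !mulnA.
have Hw' : \sum_(t < n) c' t < \sum_(t < n) c t by lia.
have IH : forall t, t < n -> c' t = e t.
  apply: IHN; [lia|lia|].
  rewrite -Hmod; apply/eqP; rewrite -(eqn_modDr (q ^ t1.+1)) v.
  by rewrite eqn_modDl eq_sym; apply/eqP; exact: expn_mod_pred.
(* The carry lowers the weight by q - 1 > 0, so c' = e would make the weight of [c] exceed that of
   [e]: no digit reaches q. *)
have : \sum_(t < n) c' t = \sum_(t < n) e t.
  by apply: eq_bigr => t _; exact: IH.
lia.
Qed.

End Digits.

Local Open Scope ring_scope.

(** * Linearized polynomials, Dickson matrices and permanents *)

Lemma mulmod_inj n d (n_gt0 : (0 < n)%N) : coprime d n ->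
  injective (fun t : 'I_n => Ordinal (ltn_pmod (d * t) n_gt0)).
Proof.
move=> dn s t /(congr1 val)/= /eqP; wlog le_st : s t / (s <= t)%N => [H|].
  by case: (leqP s t) => [|/ltnW] H'; [exact: H|rewrite eq_sym => /(H _ _ H')].
rewrite eq_sym eqn_mod_dvd ?leq_mul2l ?le_st ?orbT // -mulnBr.
rewrite Gauss_dvdr 1?coprime_sym // => dv; apply: val_inj => /=.
case: (posnP (t - s)) => [|H]; first by lia.
by have := dvdn_leq H dv; have := ltn_ord t; lia.
Qed.

(** A linearized polynomial in powers of Q. For Q = q^i with i prime to n the maps t -> t^(Q^l), l <
    n, are all the Frobenius powers of F_{q^n} over F_q, and t -> t^(q^i) sits at index 1 modulo
    n. *)
Definition lin_poly (K : fieldType) (n Q : nat) (a : nat -> K) (t : K) : K :=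
  \sum_(l < n) a l * t ^+ (Q ^ l).

(* The points of the linear set {<(t, lin_poly a t)>} other than <(0, 1)>, by their slopes. *)
Definition same_slopes (K : fieldType) (n Q : nat) (a b : nat -> K) : Prop :=
  forall v, (exists2 t, t != 0 & lin_poly n Q a t = t * v) <->
            (exists2 t, t != 0 & lin_poly n Q b t = t * v).

(** Row u holds the coefficients of the Q^u-th power of the polynomial; [w + (n - u)] stands for w -
    u, which truncated subtraction would spoil. *)
Definition dickson_mx (K : fieldType) (n Q : nat) (a : nat -> K) (u w : 'I_n) : K :=
  a ((w + (n - u)) %% n)%N ^+ (Q ^ u).

(* Permanent of the principal submatrix of A indexed by S; x0 is the junk value
   of the functions f outside S. *)
Definition principal_perm (K : fieldType) (n : nat) (x0 : 'I_n)
    (A : 'I_n -> 'I_n -> K) (S : {set 'I_n}) : K :=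
  \sum_(f in pffun_on x0 (mem S) predT | f @: S == S) \prod_(u in S) A u (f u).

(** Meant for the vertex set of a chordless cycle [f0], where every other permutation of S uses an
    absent edge. *)
Lemma principal_perm_single (K : fieldType) n (x0 : 'I_n) (A : 'I_n -> 'I_n -> K)
    (S : {set 'I_n}) (f0 : 'I_n -> 'I_n) :
  f0 @: S = S ->
  (forall f : 'I_n -> 'I_n, f @: S = S -> \prod_(u in S) A u (f u) != 0 ->
     forall u, u \in S -> f u = f0 u) ->
  principal_perm x0 A S = \prod_(u in S) A u (f0 u).
Proof.
move=> f0S Hf; pose g := [ffun u => if u \in S then f0 u else x0].
have gE u : u \in S -> g u = f0 u by rewrite ffunE => ->.
have gS : g @: S = S by rewrite -[RHS]f0S; apply: eq_in_imset.
rewrite /principal_perm (bigD1 g) /=; last first.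
  rewrite gS eqxx andbT; apply/pffun_onP; split=> //.
  by apply/supportP => u /negPf uS; rewrite ffunE uS.
rewrite [X in _ + X]big1 ?addr0 => [|f /andP[/andP[/pffun_onP[supf _] /eqP fS] fg]].
  by apply: eq_bigr => u uS; rewrite gE.
apply/eqP; apply: contraNT fg => /(Hf f fS) E; apply/eqP/ffunP => u.
case: (boolP (u \in S)) => uS; first by rewrite E ?gE.
by rewrite ffunE (negPf uS); have /supportP := supf; apply.
Qed.

Lemma diff_mod n x y :
  (0 < n)%N -> ((y %% n + (n - x %% n)) %% n + x = y %[mod n])%N.
Proof.
move=> n_gt0; have xn := ltn_pmod x n_gt0.
rewrite modnDml -modnDmr -addnA subnK ?(ltnW xn) //.
by rewrite modnDr modn_mod.
Qed.

Lemma prod_addr_subset (K : fieldType) (I : finType) (S : {set I}) (X Y : I -> K) :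
  \prod_(u in S) (X u + Y u) =
  \sum_(J : {set I} | J \subset S) \prod_(u in S) (if u \in J then X u else Y u).
Proof.
transitivity (\prod_u ((if u \in S then X u else 0) + (if u \in S then Y u else 1))).
  rewrite big_mkcond /=; apply: eq_bigr => u _.
  by case: (u \in S); rewrite ?add0r.
rewrite bigA_distr [RHS]big_mkcond /=; apply: eq_bigr => J _.
case: ifP => [/subsetP JS|/negbT/subsetPn[u uJ uS]]; last first.
  by rewrite (bigD1 u) //= uJ (negPf uS) mul0r.
rewrite [RHS]big_mkcond /=; apply: eq_bigr => u _.
by case: (boolP (u \in J)) => [/JS ->|_].
Qed.

Lemma principal_perm_add (K : fieldType) n (x0 : 'I_n) (E A : 'I_n -> 'I_n -> K)
    (y : 'I_n -> K) (S : {set 'I_n}) :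
  principal_perm x0 (fun u w => E u w * y u + A u w) S =
  \sum_(J : {set 'I_n} | J \subset S)
    principal_perm x0 (fun u w => if u \in J then E u w else A u w) S *
    \prod_(u in J) y u.
Proof.
rewrite /principal_perm.
under eq_bigr do rewrite prod_addr_subset.
rewrite exchange_big /=; apply: eq_bigr => J JS.
rewrite mulr_suml; apply: eq_bigr => f _.
rewrite [in RHS](big_setID J) [LHS](big_setID J) /= mulrAC.
congr (_ * _); last by apply: eq_bigr => u; rewrite inE => /andP[/negPf ->].
rewrite (setIidPr JS) -big_split /=; apply: eq_bigr => u ->.
by [].
Qed.

Lemma principal_perm_diff (K : fieldType) n (x0 : 'I_n) (A B : 'I_n -> 'I_n -> K)
    (S : {set 'I_n}) (f0 : 'I_n -> 'I_n) :
  f0 @: S = S ->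
  (forall f : 'I_n -> 'I_n, f @: S = S -> (exists2 u, u \in S & f u != f0 u) ->
     \prod_(u in S) A u (f u) = \prod_(u in S) B u (f u)) ->
  principal_perm x0 A S = principal_perm x0 B S ->
  \prod_(u in S) A u (f0 u) = \prod_(u in S) B u (f0 u).
Proof.
move=> f0S Hf; pose g := [ffun u => if u \in S then f0 u else x0].
have gE u : u \in S -> g u = f0 u by rewrite ffunE => ->.
have gS : g @: S = S by rewrite -[RHS]f0S; apply: eq_in_imset.
have gP : (g \in pffun_on x0 (mem S) predT) && (g @: S == S).
  rewrite gS eqxx andbT; apply/pffun_onP; split=> //.
  by apply/supportP => u /negPf uS; rewrite ffunE uS.
have gpr C : \prod_(u in S) C u (g u) = \prod_(u in S) C u (f0 u) :> K.
  by apply: eq_bigr => u uS; rewrite gE.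
rewrite /principal_perm (bigD1 g) //= [in RHS](bigD1 g) //= !gpr.
set X := (X in _ + X = _); set Y := (Y in _ = _ + Y).
suff -> : X = Y by move/addIr.
apply: eq_bigr => f /andP[/andP[/pffun_onP[supf _] /eqP fS] fg]; apply: Hf => //.
have [/existsP[u /andP[uS fu]]|] := boolP [exists u, (u \in S) && (f u != f0 u)].
  by exists u.
rewrite negb_exists => /forallP H; case/eqP: fg; apply/ffunP => u.
case: (boolP (u \in S)) => uS.
  by have := H u; rewrite uS negbK gE // => /eqP.
by rewrite ffunE (negPf uS); have /supportP := supf; apply.
Qed.

(** * Slopes of linearized polynomials over a finite field *)

Section FiniteField.
Variables (K : finFieldType) (q n i : nat).
Hypotheses (n_gt0 : (0 < n)%N) (cardK : #|K| = (q ^ n)%N).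
Hypotheses (q_char : [pchar K].-nat q) (coprime_in : coprime i n).
Let Q := (q ^ i)%N.

Lemma base_gt1 : (1 < q)%N.
Proof.
have := finNzRing_gt1 K; rewrite cardK; case: q => [|[|//]].
  by rewrite exp0n.
by rewrite exp1n.
Qed.

(** Modulo q^n - 1 the power Q^t equals q^(i t mod n), and t -> i t permutes the residues since i is
    prime to n; the claim becomes uniqueness of cyclic base-q digits. A proper S leaves a digit
    equal to zero: for q = 2 the full set and the empty set have congruent sums. *)
Lemma pow_mod_inj (c : 'I_n -> nat) (S : {set 'I_n}) :
  S != setT -> (\sum_t c t <= #|S|)%N ->
  (\sum_t c t * Q ^ t = \sum_(t in S) Q ^ t %[mod (q ^ n).-1])%N ->
  forall t, c t = (t \in S).
Proof.
move=> /eqP SnT cS Hmod.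
pose k (t : 'I_n) : 'I_n := Ordinal (ltn_pmod (i * t) n_gt0).
have k_inj : injective k := mulmod_inj (n_gt0 := n_gt0) coprime_in.
have kE (c' : 'I_n -> nat) : (\sum_t c' t * Q ^ t =
    \sum_(u < n) (\sum_(t | k t == u :> nat) c' t) * q ^ u %[mod (q ^ n).-1])%N.
  have -> : (\sum_(u < n) (\sum_(t | k t == u :> nat) c' t) * q ^ u)%N
      = (\sum_t c' t * q ^ k t)%N.
    rewrite [RHS](partition_big k predT) //=; apply: eq_bigr => u _.
    by rewrite big_distrl /=; apply: eq_bigr => t /eqP /= ->.
  rewrite -modn_summ -[RHS]modn_summ.
  congr (_ %% _)%N; apply: eq_bigr => t _.
  by rewrite -modnMmr -expnM (expn_mod_pred base_gt1) // modnMmr.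
pose cc u := (\sum_(t | k t == u :> nat) c t)%N.
pose e u := (\sum_(t | k t == u :> nat) (t \in S))%N.
have one (c' : 'I_n -> nat) t : (\sum_(s | k s == k t :> nat) c' s)%N = c' t.
  rewrite (eq_bigl (pred1 t)) ?big_pred1_eq // => s.
  by apply/eqP/eqP => [/val_inj/k_inj|->].
have surj u : (u < n)%N -> exists t, u = k t.
  move=> Hu; have [t Ht] : exists t, k t = Ordinal Hu.
    by exists (invF k_inj (Ordinal Hu)); rewrite f_invF.
  by exists t; rewrite Ht.
have tot (c' : 'I_n -> nat) :
    (\sum_(u < n) \sum_(t | k t == u :> nat) c' t = \sum_t c' t)%N.
  by rewrite [RHS](partition_big k predT).
move=> t; rewrite -(one c t) -(one (fun s => (s \in S) : nat) t).
apply: (@cyclic_digits_inj q base_gt1 n cc e) => //.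
- by move=> u /surj[s ->]; rewrite /e one leq_b1.
- have /set0Pn[s] : ~: S != set0.
    by apply/eqP => /(congr1 (@setC _)); rewrite setCK setC0.
  by rewrite inE => /negPf sS; exists (k s) => //; rewrite /e one sS.
- by rewrite /cc /e !tot -big_mkcond /= sum1_card.
rewrite -kE Hmod big_mkcond /= -(kE (fun s => (s \in S) : nat)).
by congr (_ %% _)%N; apply: eq_bigr => s _; case: (s \in S); rewrite ?mul1n.
Qed.

Lemma pow_mod_inj_set (R S : {set 'I_n}) : R != setT -> S != setT ->
  (\sum_(t in R) Q ^ t == \sum_(t in S) Q ^ t %[mod (q ^ n).-1])%N = (R == S).
Proof.
have H (A B : {set 'I_n}) : B != setT -> (#|A| <= #|B|)%N ->
   (\sum_(t in A) Q ^ t = \sum_(t in B) Q ^ t %[mod (q ^ n).-1])%N -> A = B.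
  move=> BT AB E; apply/setP => t.
  have := @pow_mod_inj (fun s => (s \in A) : nat) B BT.
  rewrite -big_mkcond /= sum1_card => /(_ AB).
  have -> : (\sum_t (t \in A) * Q ^ t = \sum_(t in A) Q ^ t)%N.
    rewrite [RHS]big_mkcond /=; apply: eq_bigr => s _.
    by case: (s \in A); rewrite ?mul1n.
  by move=> /(_ E t); case: (t \in A); case: (t \in B).
move=> RT ST; apply/eqP/eqP => [E|-> //].
case: (leqP #|R| #|S|) => [|/ltnW] C; first exact: H.
by symmetry; exact: H.
Qed.

(** The fibre sizes of f on S serve as digits of total weight #|S|; by uniqueness they form the
    indicator of S, so f hits each element of S once and nothing else. *)
Lemma pow_mod_inj_fun (f : 'I_n -> 'I_n) (S : {set 'I_n}) : S != setT ->
  (\sum_(t in S) Q ^ f t == \sum_(t in S) Q ^ t %[mod (q ^ n).-1])%N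
    = (f @: S == S).
Proof.
move=> ST; apply/idP/idP => [/eqP E|/eqP fS]; last first.
  have /imset_injP f_inj : #|f @: S| == #|S| by rewrite fS.
  by rewrite -{2}fS (big_imset _ f_inj).
pose c u := (\sum_(t in S | f t == u) 1)%N.
have cE (F : 'I_n -> nat) : (\sum_u c u * F u = \sum_(t in S) F (f t))%N.
  rewrite [RHS](partition_big f predT) //=; apply: eq_bigr => u _.
  by rewrite big_distrl /=; apply: eq_bigr => t /andP[_ /eqP->]; rewrite mul1n.
have Hc u : c u = (u \in S).
  apply: (pow_mod_inj ST); last by rewrite cE.
  have := cE (fun=> 1%N); under eq_bigr do rewrite muln1.
  by move=> ->; rewrite sum1_card.
apply/eqP/setP => u; have := Hc u; rewrite /c sum1dep_card.
case: (boolP (u \in S)) => uS cu.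
  have /card_gt0P[t] : (0 < #|[set t in S | f t == u]|)%N by rewrite cu.
  by rewrite inE => /andP[tS /eqP <-]; apply/imset_f.
apply/negbTE/imsetP => -[t tS Et]; have := cu => /eqP.
by rewrite cards_eq0 => /eqP/setP/(_ t); rewrite !inE tS -Et eqxx.
Qed.

(** Orthogonality of the power characters of the cyclic group of units. In the trivial case the sum
    counts q^n - 1 units, which is -1 in K; otherwise the substitution x -> y x by a generator y
    multiplies the sum by a factor other than 1. *)
Lemma sum_unit_pow (e k : nat) : \sum_(x : K | x != 0) x ^+ e / x ^+ k =
  if (e == k %[mod (q ^ n).-1])%N then -1 else 0.
Proof.
have cyc : cyclic [set: {unit K}] by exact: field_unit_group_cyclic.
have [g gE] := cyclicP cyc.
have og : #[g]%g = (q ^ n).-1 by rewrite orderE -gE card_finField_unit cardK.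
pose y : K := val g.
have y0 : y != 0 by rewrite -unitfE; exact: (valP g).
have yE : (y ^+ e == y ^+ k) = (e == k %[mod (q ^ n).-1])%N.
  by rewrite -!val_unitX (inj_eq val_inj) eq_expg_mod_order og.
case: ifP => E.
  have all1 (x : K) : x != 0 -> x ^+ e / x ^+ k = 1.
    move=> x0; have xU : x \is a GRing.unit by rewrite unitfE.
    have : FinRing.unit K xU \in <[g]>%g by rewrite -gE inE.
    case/cycleP => m /(congr1 val) /=; rewrite val_unitX -/y => ->.
    have /eqP yek : y ^+ e == y ^+ k by rewrite yE.
    by rewrite -!exprM mulnC exprM yek mulnC exprM exprAC divff // !expf_neq0.
  rewrite (eq_bigr (fun=> 1)) // sumr_const.
  have -> : #|[pred x : K | x != 0]| = (q ^ n).-1 by rewrite cardC1 cardK.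
  have qn : ((q ^ n)%N)%:R = 0 :> K.
    have [p p_pr pK] := finPcharP K; have pq : (p %| q ^ n)%N.
      rewrite -cardK.
      have := finNzRing_gt1 K.
      have : p.-nat #|K| by rewrite -cardsT; exact: (pprimeChar_pgroup pK).
      by case/p_natP=> -[|m] -> // _; rewrite expnS dvdn_mulr.
    by apply/eqP; rewrite -(dvdn_pcharf pK).
  have q_n : (0 < q ^ n)%N by rewrite -cardK (ltnW (finNzRing_gt1 K)).
  by apply/eqP; rewrite -addr_eq0 -[X in _ + X](mulr1n 1) -mulrSr prednK ?qn.
set s := \sum_(x | _) _.
have : y ^+ e / y ^+ k * s = s.
  rewrite /s big_distrr /= [RHS](reindex_onto ( *%R y) ( *%R y^-1)) /=.
    rewrite [RHS](eq_bigl [pred x | x != 0]) => [|x /=]; last first.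
      by rewrite mulf_eq0 (negPf y0) /= mulKf // eqxx andbT.
    apply: eq_bigr => x x0.
    by rewrite !exprMn invfM mulrACA.
  by move=> x _; rewrite mulVKf.
move/eqP; rewrite -subr_eq0 -{2}[s]mul1r -mulrBl mulf_eq0 subr_eq0.
case/orP => [|/eqP//].
rewrite -(inj_eq (mulIf (expf_neq0 k y0))) divfK ?expf_neq0 // mul1r.
by rewrite yE E.
Qed.

(** * Power sums of slopes as principal permanents *)

Implicit Types (a b : nat -> K) (t v x y : K).

Lemma frobD u (x y : K) : (x + y) ^+ (Q ^ u) = x ^+ (Q ^ u) + y ^+ (Q ^ u).
Proof. by apply: exprDn_pchar; rewrite /Q !pnatX q_char. Qed.

Lemma frob0 u : 0 ^+ (Q ^ u) = 0 :> K.
Proof.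
have q0 := ltnW base_gt1.
by rewrite expr0n expn_eq0 expn_eq0 (gtn_eqF q0).
Qed.

Lemma frob_sum u I r (P : pred I) (F : I -> K) :
  (\sum_(j <- r | P j) F j) ^+ (Q ^ u) = \sum_(j <- r | P j) F j ^+ (Q ^ u).
Proof. by apply: (big_morph (fun x => x ^+ (Q ^ u))) => [x y|]; [exact: frobD|exact: frob0]. Qed.

Lemma frobN u (x : K) : (- x) ^+ (Q ^ u) = - x ^+ (Q ^ u).
Proof. by apply/eqP; rewrite -addr_eq0 -frobD addNr frob0. Qed.

Lemma frob_mod u (x : K) : x ^+ (Q ^ (u %% n)) = x ^+ (Q ^ u).
Proof.
rewrite [in RHS](divn_eq u n) expnD [RHS]exprM.
congr (_ ^+ _); rewrite -expnM mulnA mulnC expnM -cardK.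
by elim: (i * _)%N => [|m IHm]; rewrite ?expr1 // expnSr exprM -IHm expf_card.
Qed.

Lemma lin_polyD a x y :
  lin_poly n Q a (x + y) = lin_poly n Q a x + lin_poly n Q a y.
Proof.
by rewrite -big_split; apply: eq_bigr => l _ /=; rewrite frobD mulrDr.
Qed.

Lemma lin_poly0 a : lin_poly n Q a 0 = 0.
Proof. by apply: big1 => l _; rewrite frob0 mulr0. Qed.

Lemma lin_poly_frob a t (u : 'I_n) :
  lin_poly n Q a t ^+ (Q ^ u) = \sum_(w < n) dickson_mx Q a u w * t ^+ (Q ^ w).
Proof.
pose h (w : 'I_n) : 'I_n := Ordinal (ltn_pmod (w + (n - u)) n_gt0).
pose h' (l : 'I_n) : 'I_n := Ordinal (ltn_pmod (l + u) n_gt0).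
have un := ltn_ord u.
have hK : cancel h h'.
  move=> w; apply: val_inj; rewrite /= modnDml -addnA subnK ?(ltnW un) //.
  by rewrite modnDr modn_small.
have h'K : cancel h' h.
  move=> l; apply: val_inj; rewrite /= modnDml -addnA subnKC ?(ltnW un) //.
  by rewrite modnDr modn_small.
rewrite frob_sum (reindex h) /=; last by exists h' => w _.
apply: eq_bigr => w _; rewrite exprMn -exprM -expnD -(frob_mod (_ %% _ + u) t).
by congr (_ * t ^+ (Q ^ _)); exact: (congr1 val (hK w)).
Qed.

(** Each factor indexed by s is row s of the Dickson matrix applied to the powers of t, so the
    expansion runs over functions f on S, with exponents Q^(f s) against Q^s; orthogonality keeps
    exactly those f that permute S. *)
Lemma sum_slopes_pow (x0 : 'I_n) a (S : {set 'I_n}) : S != setT ->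
  \sum_(t : K | t != 0) (lin_poly n Q a t / t) ^+ (\sum_(s in S) Q ^ s)
    = - principal_perm x0 (dickson_mx Q a) S.
Proof.
move=> ST; set k := (\sum_(s in S) _)%N.
have E t : (lin_poly n Q a t / t) ^+ k =
    \sum_(f in pffun_on x0 (mem S) predT) (\prod_(u in S) dickson_mx Q a u (f u)) *
      (t ^+ (\sum_(s in S) Q ^ f s) / t ^+ k).
  rewrite expr_div_n /k expr_sum.
  rewrite (eq_bigr _ (fun (s : 'I_n) _ => lin_poly_frob a t s)).
  rewrite (big_distr_big x0) /= mulr_suml; apply: eq_bigr => f _.
  by rewrite big_split /= -expr_sum mulrA.
rewrite (eq_bigr _ (fun t _ => E t)).
rewrite exchange_big /= /principal_perm -sumrN big_mkcondr /=.
apply: eq_bigr => f _; rewrite -mulr_sumr sum_unit_pow.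
rewrite pow_mod_inj_fun //.
by case: ifP; rewrite ?mulrN1 ?mulr0.
Qed.

(** The solutions t, zero included, form an additive subgroup; if it is nontrivial, its order is a
    power of p greater than 1, hence zero in K, and discarding t = 0 leaves -1. *)
Lemma card_slope_fibre a v :
  (#|[pred t | t != 0 & lin_poly n Q a t == t * v]|)%:R =
  if [exists t, (t != 0) && (lin_poly n Q a t == t * v)] then -1 else 0 :> K.
Proof.
case: existsP => [[t0 /andP[t00 Ht0]]|ne]; last first.
  rewrite eq_card0 // => t; rewrite !inE.
  by apply/negbTE/negP => H; apply: ne; exists t.
pose H := [set t | lin_poly n Q a t == t * v].
have Hg : group_set H.
  apply/group_setP; split=> [|x y]; rewrite !inE; first by rewrite lin_poly0 mul0r.
  by move=> /eqP Hx /eqP Hy; rewrite zmodMgE lin_polyD Hx Hy mulrDl.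
have [p p_pr pK] := finPcharP K.
have pH : (p.-group (Group Hg))%g.
  apply: (pgroupS (subsetT _)); exact: (pprimeChar_pgroup pK).
have dvH : (p %| #|H|)%N.
  have : (1 < #|H|)%N.
    by apply/card_gt1P; exists 0, t0; rewrite !inE lin_poly0 mul0r eqxx Ht0 eq_sym.
  by move: pH; rewrite /pgroup /= => /p_natP[[|m] ->] // _; rewrite expnS dvdn_mulr.
have : (#|H|)%:R == 0 :> K by rewrite -(dvdn_pcharf pK).
rewrite (cardsD1 0) inE lin_poly0 mul0r eqxx natrD addrC addr_eq0 => /eqP <-.
by congr _%:R; apply: eq_card => t; rewrite !inE.
Qed.

Lemma same_slopes_sum_pow a b k : same_slopes n Q a b ->
  \sum_(t : K | t != 0) (lin_poly n Q a t / t) ^+ k =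
  \sum_(t : K | t != 0) (lin_poly n Q b t / t) ^+ k.
Proof.
have E c : \sum_(t : K | t != 0) (lin_poly n Q c t / t) ^+ k = \sum_v
   (if [exists t, (t != 0) && (lin_poly n Q c t == t * v)] then -1 else 0) * v ^+ k.
  rewrite (partition_big (fun t => lin_poly n Q c t / t) predT) //=.
  apply: eq_bigr => v _; rewrite -card_slope_fibre.
  rewrite (eq_bigr (fun=> v ^+ k)) => [|t /andP[_ /eqP-> //]].
  rewrite sumr_const mulr_natl; congr (_ *+ _); apply: eq_card => t; rewrite !inE.
  rewrite unfold_in; case: (boolP (t != 0)) => //= t0.
  by apply/eqP/eqP => [<-|->]; [rewrite mulrC divfK|rewrite mulrAC divff ?mul1r].
move=> ab; rewrite !E; apply: eq_bigr => v _; congr (_ * _).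
congr (if _ then _ else _); have [h1 h2] := ab v.
apply/existsP/existsP => -[t /andP[t0 /eqP Ht]].
  by have [|s s0 Hs] := h1 _; [exists t|exists s; rewrite s0 Hs eqxx].
by have [|s s0 Hs] := h2 _; [exists t|exists s; rewrite s0 Hs eqxx].
Qed.

Lemma same_slopes_perm (x0 : 'I_n) a b (S : {set 'I_n}) : same_slopes n Q a b ->
  S != setT -> principal_perm x0 (dickson_mx Q a) S =
    principal_perm x0 (dickson_mx Q b) S.
Proof.
move=> ab ST; apply: oppr_inj; rewrite -!sum_slopes_pow //.
exact: same_slopes_sum_pow.
Qed.

(** Dividing by the monomial of R and summing over nonzero s isolates [c R], because the exponents
    of distinct proper subsets are incongruent modulo q^n - 1. The full set is set aside by
    [c setT = 0]: for q = 2 it shares its class with the empty set. *)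
Lemma multilinear_frob_inj (c : {set 'I_n} -> K) : c setT = 0 ->
  (forall s, \sum_R c R * \prod_(w in R) s ^+ (Q ^ w) = 0) ->
  forall R, c R = 0.
Proof.
move=> cT H R; have [->//|RT] := eqVneq R setT.
have : \sum_(s : K | s != 0) \sum_A c A *
    (s ^+ (\sum_(w in A) Q ^ w) / s ^+ (\sum_(w in R) Q ^ w)) = 0.
  apply: big1 => s _; have := congr1 ( *%R^~ (s ^- (\sum_(w in R) Q ^ w))) (H s).
  rewrite mul0r mulr_suml; apply: etrans; apply: eq_bigr => A _.
  by rewrite -expr_sum mulrA.
rewrite exchange_big /= (bigD1 R) //= -mulr_sumr sum_unit_pow.
rewrite eqxx mulrN1 big1 ?addr0 => [/eqP|A AR]; first by rewrite oppr_eq0 => /eqP.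
rewrite -mulr_sumr; have [->|AT] := eqVneq A setT; first by rewrite cT mul0r.
rewrite sum_unit_pow pow_mod_inj_set //.
by rewrite (negPf AR) mulr0.
Qed.

(** The partial sums modulo n are the vertices of a closed walk. A repeated vertex or a chord would
    produce a shorter zero-sum sequence, excluded by induction; without them a walk of fewer than n
    steps spans a proper S whose permanent is one nonzero product. *)
Lemma zero_sum_size (x0 : 'I_n) a (s : seq nat) :
  (forall S : {set 'I_n}, S != set0 -> S != setT ->
     principal_perm x0 (dickson_mx Q a) S = 0) ->
  (0 < size s)%N -> all (fun l => (l < n)%N && (a l != 0)) s ->
  (n %| sumn s)%N -> (n <= size s)%N.
Proof.
move=> a0; move: {2}(size s) (erefl (size s)) => m.
elim/ltn_ind: m s => m IH s sm s0 sA sn; rewrite leqNgt sm; apply/negP => mn.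
have {}IH s' : (0 < size s' < m)%N -> all (fun l => (l < n)%N && (a l != 0)) s' ->
    (n %| sumn s')%N -> False.
  move=> /andP[s'0 s'm] s'A s'n.
  by have := IH _ s'm s' erefl s'0 s'A s'n; lia.
rewrite sm in s0.
pose p k := sumn (take k s).
pose v k : 'I_n := Ordinal (ltn_pmod (p k) n_gt0).
have pm : (n %| p m)%N by rewrite /p -sm take_size.
have vm : v m = v 0.
  by apply: val_inj; rewrite /= /p take0 mod0n; apply/eqP.
have pS k : (k < m)%N -> p k.+1 = (p k + nth 0%N s k)%N.
  by move=> km; rewrite /p (take_nth 0%N) ?sm // sumn_rcons.
have pseg l k : (l <= k)%N -> p k = (p l + sumn (take (k - l) (drop l s)))%N.
  by move=> lk; rewrite /p -sumn_cat -takeD subnKC.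
have segA l k : all (fun l => (l < n)%N && (a l != 0)) (take k (drop l s)).
  apply/allP => x /mem_take/mem_drop; exact: (allP sA).
have segsz l k : (l <= k <= m)%N -> size (take (k - l) (drop l s)) = (k - l)%N.
  by move=> lk; rewrite size_take_min size_drop sm; lia.
have v_inj j k : (j < k < m)%N -> v j <> v k.
  move=> jkm /(congr1 val)/= E; apply: (IH (take (k - j) (drop j s))).
  - by rewrite segsz; lia.
  - exact: segA.
  have jk : (j <= k)%N by lia.
  have : (p j == p k %[mod n])%N by apply/eqP.
  by rewrite (pseg j k jk) -{1}[p j]addn0 eqn_modDl mod0n eq_sym.
(* Targets are indexed by 1..m, so the start counts as [v m]. A chord from k back to l <= k closes
   up with the steps from l to k; a chord forward past k + 1 closes up with the steps from l to m
   and then from 0 to k. *)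
have chord k l : (k < m)%N -> (0 < l <= m)%N ->
    a ((v l + (n - v k)) %% n)%N != 0 -> l = k.+1.
  move=> km l0m; set d := (_ %% n)%N => ad.
  have dn : (d < n)%N by exact: ltn_pmod.
  have dE : (d + p k = p l %[mod n])%N by exact: diff_mod.
  case: (ltngtP l k.+1) => // lk; exfalso.
    apply: (IH (d :: take (k - l) (drop l s))).
    - by rewrite /= segsz; lia.
    - by rewrite /= dn ad segA.
    have lk' : (l <= k)%N by lia.
    move/eqP: dE; rewrite (pseg l k lk') addnCA -{2}[p l]addn0 eqn_modDl mod0n.
    by [].
  apply: (IH (d :: take (m - l) (drop l s) ++ take (k - 0) (drop 0 s))).
  - by rewrite /= size_cat !segsz; lia.
  - by rewrite /= dn ad all_cat !segA.
  have lm : (l <= m)%N by lia.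
  rewrite /= sumn_cat addnCA drop0 subn0 -/(p k).
  have : (p l + sumn (take (m - l) (drop l s)) == 0 %[mod n])%N.
    by rewrite -pseg // mod0n.
  by rewrite -modnDml -dE modnDml /dvdn addnC addnA addnAC addnC mod0n addnCA addnC.
pose S := [set v k | k : 'I_m].
have inS k : (k <= m)%N -> v k \in S.
  rewrite leq_eqVlt => /orP[/eqP->|km]; last by apply/imsetP; exists (Ordinal km).
  by rewrite vm; apply/imsetP; exists (Ordinal s0).
have Sin u : u \in S -> exists2 l, (0 < l <= m)%N & u = v l.
  case/imsetP => -[[|k] km] _ -> /=; first by exists m; rewrite ?vm ?s0 ?leqnn.
  by exists k.+1 => //; rewrite (ltnW km).
have SnT : S != setT.
  apply/eqP => /(congr1 (fun X : {set _} => #|X|)); rewrite cardsT card_ord => Sn.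
  have := leq_imset_card (fun k : 'I_m => v k) predT.
  by rewrite card_ord -/S Sn; lia.
have Sn0 : S != set0 by apply/set0Pn; exists (v 0); exact: inS.
pose idx (u : 'I_n) := index u [seq v k | k <- iota 0 m].
have idxE k : (k < m)%N -> idx (v k) = k.
  move=> km; have Hu : uniq [seq v k | k <- iota 0 m].
    rewrite map_inj_in_uniq ?iota_uniq // => x y; rewrite !mem_iota => xm ym E.
    case: (ltngtP x y) => // xy; exfalso.
      by apply: (@v_inj x y) => //; lia.
    by apply: (@v_inj y x) => //; lia.
  by rewrite /idx -{1}[k](nth_iota 0 0 km) -(nth_map 0%N (v 0)) ?size_iota //
    index_uniq ?size_map ?size_iota.
have SinK u : u \in S -> exists2 k, (k < m)%N & u = v k.
  by case/imsetP => k _ ->; exists k.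
pose f0 u := v (idx u).+1.
have f0v k : (k < m)%N -> f0 (v k) = v k.+1 by move=> km; rewrite /f0 idxE.
have f0S : f0 @: S = S.
  apply/setP => u; apply/imsetP/idP => [[w /SinK[k km ->] ->]|/Sin[l lm ->]].
    by rewrite f0v // inS.
  by exists (v l.-1); rewrite ?inS ?f0v ?prednK //; lia.
have uniq_f f : f @: S = S -> \prod_(u in S) dickson_mx Q a u (f u) != 0 ->
    forall u, u \in S -> f u = f0 u.
  move=> fS nz u uS; have /Sin[l lm fl] : f u \in S by rewrite -fS imset_f.
  have [k km uk] := SinK u uS.
  have : dickson_mx Q a u (f u) != 0.
    by apply: contraNneq nz => z; rewrite (bigD1 u) //= z mul0r.
  rewrite /dickson_mx fl uk f0v // => H; congr v; apply: chord => //.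
  by apply: contraNneq H => ->; rewrite frob0.
have := a0 S Sn0 SnT; rewrite (principal_perm_single x0 f0S uniq_f).
move/eqP; apply/negP/prodf_neq0 => u /SinK[k km ->]; rewrite f0v //.
apply: expf_neq0; have := allP sA (nth 0%N s k); rewrite mem_nth ?sm // => /(_ isT).
case/andP => kn; congr (a _ != 0).
have := diff_mod (p k) (p k.+1) n_gt0; rewrite pS // addnC => /eqP.
by rewrite eqn_modDl modn_mod => /eqP E; rewrite /= pS // E modn_small.
Qed.

Lemma lin_poly_delta d (alpha t : K) : (d < n)%N ->
  lin_poly n Q (fun l => if l == d then alpha else 0) t = alpha * t ^+ (Q ^ d).
Proof.
move=> dn; rewrite /lin_poly (bigD1 (Ordinal dn)) //= eqxx big1 ?addr0 // => l ld.
by case: eqP => [E|]; rewrite ?mul0r //; case/eqP: ld; apply: val_inj.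
Qed.

(** A nonzero term moves every u in S to u + 1, and a nonempty S closed under this step is
    everything. The index [1 %% n] also covers n = 1. *)
Lemma principal_perm_delta1 (x0 : 'I_n) (alpha : K) (S : {set 'I_n}) :
  S != set0 -> S != setT -> principal_perm x0
    (dickson_mx Q (fun l => if l == (1 %% n)%N then alpha else 0)) S = 0.
Proof.
move=> /set0Pn[u0 u0S] ST; apply: big1 => f /andP[_ /eqP fS].
apply/eqP; apply: contraNT ST => nz.
have step u : u \in S -> Ordinal (ltn_pmod u.+1 n_gt0) \in S.
  move=> uS; have : dickson_mx Q
      (fun l => if l == (1 %% n)%N then alpha else 0) u (f u) != 0.
    by apply: contraNneq nz => z; rewrite (bigD1 u) //= z mul0r.
  rewrite /dickson_mx; case: (_ =P (1 %% n)%N) => [E _|_]; last by rewrite frob0 eqxx.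
  suff <- : f u = Ordinal (ltn_pmod u.+1 n_gt0) by rewrite -fS imset_f.
  apply: val_inj => /=; have := diff_mod u (f u) n_gt0.
  by rewrite !(modn_small (ltn_ord _)) E modnDml add1n => ->.
have steps k : Ordinal (ltn_pmod (u0 + k) n_gt0) \in S.
  elim: k => [|k /step]; first by congr (_ \in S): u0S; apply: val_inj; rewrite /= addn0 modn_small.
  by congr (_ \in S); apply: val_inj; rewrite /= -addn1 modnDml addn1 addnS.
apply/eqP/setP => w; rewrite inE; have := steps (n - u0 + w)%N; congr (_ \in S).
by apply: val_inj; rewrite /= addnA subnKC ?modnDl ?modn_small // ltnW.
Qed.

(* A shortest closed walk 0, c_1, c_1 + c_2, ... with steps in the support of a
   has no chord, so its vertex set carries a single nonzero term of the
   permanent; hence every zero-sum sequence over the support has at least n terms. *)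
Lemma same_slopes_monomial a (alpha : K) : alpha != 0 ->
  same_slopes n Q a (fun l => if l == (1 %% n)%N then alpha else 0) ->
  exists d, [/\ (d < n)%N, coprime d n, a d != 0 &
    forall l, (l < n)%N -> l != d -> a l = 0].
Proof.
move=> alpha0 ab; pose x0 := Ordinal n_gt0.
have zs s := @zero_sum_size x0 a s
  (fun S S0 ST => etrans (same_slopes_perm x0 ab ST)
                         (principal_perm_delta1 x0 alpha S0 ST)).
have [d ad] : exists d : 'I_n, a d != 0.
  apply/existsP; apply: contraT; rewrite negb_exists => /forallP az.
  have [_ [|t t0]] := ab alpha.
    exists 1; first exact: oner_neq0.
    by rewrite lin_poly_delta ?ltn_pmod // expr1n mulr1 mul1r.
  rewrite /lin_poly big1 => [/esym/eqP|l _]; first by rewrite mulf_eq0 (negPf t0) (negPf alpha0).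
  by have /negPn/eqP -> := az l; rewrite mul0r.
have dn := ltn_ord d.
have cop : coprime d n.
  have g0 : (0 < gcdn d n)%N by rewrite gcdn_gt0 n_gt0 orbT.
  have := zs (nseq (n %/ gcdn d n) (val d)).
  rewrite size_nseq all_nseq dn ad orbT sumn_nseq divn_gt0 // dvdn_leq ?dvdn_gcdr //.
  have -> : (n %| d * (n %/ gcdn d n))%N.
    rewrite muln_divA ?dvdn_gcdr // mulnC -muln_divA ?dvdn_gcdl //.
    exact: dvdn_mulr.
  move=> /(_ isT isT isT) H; rewrite /coprime.
  have := leq_trunc_div n (gcdn d n); have := H.
  by case: (gcdn d n) g0 => // -[|g] // _; nia.
exists d; split=> // c cn; apply: contraNeq => ac.
(* k solves d k = -c modulo n, so one c and k copies of d sum to zero; the length bound forces k = n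
   - 1, that is c = d. *)
pose k := invF (mulmod_inj (n_gt0 := n_gt0) cop) (Ordinal (ltn_pmod (n - c) n_gt0)).
have kE : (d * k = n - c %[mod n])%N.
  exact: (congr1 val (f_invF (mulmod_inj (n_gt0 := n_gt0) cop) (Ordinal (ltn_pmod (n - c) n_gt0)))).
have := zs (c :: nseq k (val d)); rewrite /= size_nseq all_nseq cn ac dn ad orbT sumn_nseq.
have ck : (n %| c + d * k)%N by rewrite /dvdn -modnDmr kE modnDmr subnKC ?modnn // ltnW.
move=> /(_ isT isT ck) nk; have kn : (k : nat) = n.-1 by have := ltn_ord k; lia.
have : (c == d %[mod n])%N.
  rewrite -(eqn_modDr (d * n.-1)) -mulnS prednK // modnMl -kn; exact: ck.
by rewrite !modn_small.
Qed.

(** * Varying one coefficient with a parameter s *)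

Let x0 : 'I_n := Ordinal n_gt0.

Definition shift_ord d (u : 'I_n) : 'I_n := Ordinal (ltn_pmod (u + d) n_gt0).

Lemma shift_ord_inj d : injective (shift_ord d).
Proof.
move=> u w /(congr1 val)/= /eqP; rewrite eqn_modDr !modn_small // => /eqP.
exact: val_inj.
Qed.

(* Adding alpha s^(Q^d) to the d-th coefficient of a perturbs the Dickson matrix
   linearly in s^(Q^(u + d)) on row u; the rows in J keep only the factor of that
   power, so the permanents of step_mx are the coefficients of monomials in s. *)
Definition step_mx d (alpha : K) a (J : {set 'I_n}) (u w : 'I_n) : K :=
  if u \in J then (if ((w + (n - u)) %% n == d)%N then alpha ^+ (Q ^ u) else 0)
  else dickson_mx Q a u w.

(** Row u of the Dickson matrix changes by a multiple of s^(Q^(u + d)), so the rows in J produce the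
    monomial of the shifted set R = J + d. Indexing by R and not by J lets different shifts d be
    compared monomial by monomial. *)
Lemma principal_perm_step (d : nat) alpha a (S : {set 'I_n}) (s : K) :
  principal_perm x0 (dickson_mx Q
     (fun l => a l + (if l == d then alpha * s ^+ (Q ^ d) else 0))) S =
  \sum_(R : {set 'I_n})
    (if shift_ord d @^-1: R \subset S then
       principal_perm x0 (step_mx d alpha a (shift_ord d @^-1: R)) S else 0) *
    \prod_(w in R) s ^+ (Q ^ w).
Proof.
pose E (u w : 'I_n) := if ((w + (n - u)) %% n == d)%N then alpha ^+ (Q ^ u) else 0.
pose y (u : 'I_n) := s ^+ (Q ^ shift_ord d u).
transitivity (principal_perm x0 (fun u w => E u w * y u + dickson_mx Q a u w) S).
  apply: eq_bigr => f _; apply: eq_bigr => u _.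
  rewrite /dickson_mx frobD addrC /E /y /= frob_mod.
  congr (_ + _); case: eqP => _; last by rewrite frob0 mul0r.
  by rewrite exprMn -exprM -expnD addnC.
rewrite principal_perm_add big_mkcond /=.
rewrite (reindex_onto (fun R : {set 'I_n} => shift_ord d @^-1: R)
  (fun J : {set 'I_n} => shift_ord d @: J)) /=; last first.
  by move=> J _; apply/setP => u; rewrite inE (mem_imset _ _ (@shift_ord_inj d)).
apply: eq_big => [R|R _].
  suff -> : shift_ord d @: (shift_ord d @^-1: R) = R by rewrite eqxx.
  apply/setP => w; apply/imsetP/idP => [[u]|wR].
    by rewrite inE => ? ->.
  exists (invF (@shift_ord_inj d) w); last by rewrite f_invF.
  by rewrite inE f_invF.
case: ifP => // _; last by rewrite mul0r.
congr (_ * _); rewrite /y [RHS](reindex (shift_ord d)) /=.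
  by apply: eq_bigl => u; rewrite inE.
exists (invF (@shift_ord_inj d)) => w _; [exact: invF_f|exact: f_invF].
Qed.

Lemma same_slopes_step_perm a b alpha beta (d d' : nat) (S R : {set 'I_n}) :
  (forall s, same_slopes n Q
     (fun l => a l + (if l == d then alpha * s ^+ (Q ^ d) else 0))
     (fun l => b l + (if l == d' then beta * s ^+ (Q ^ d') else 0))) ->
  S != setT ->
  (if shift_ord d @^-1: R \subset S then
     principal_perm x0 (step_mx d alpha a (shift_ord d @^-1: R)) S else 0) =
  (if shift_ord d' @^-1: R \subset S then
     principal_perm x0 (step_mx d' beta b (shift_ord d' @^-1: R)) S else 0).
Proof.
move=> H ST; apply/eqP; rewrite -subr_eq0; apply/eqP; move: R.
(* Comparison of the coefficients of the monomials in s. At R = setT both sides vanish, since the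
   preimage is the full set and S is proper. *)
apply: (multilinear_frob_inj).
  by rewrite !preimsetT !subTset (negPf ST) subr0.
move=> s; under eq_bigr do rewrite mulrBl.
rewrite sumrB -!principal_perm_step; apply/eqP; rewrite subr_eq0; apply/eqP.
exact: (same_slopes_perm).
Qed.

Lemma dickson_neq0 a (u w : 'I_n) : (dickson_mx Q a u w != 0) = (a ((w + (n - u)) %% n)%N != 0).
Proof. by rewrite /dickson_mx expf_eq0 !expn_gt0 (ltnW base_gt1). Qed.

Lemma same_slopes_coef0 a b : (1 < n)%N -> same_slopes n Q a b -> a 0%N = b 0%N.
Proof.
move=> n1 ab.
have H c : principal_perm x0 (dickson_mx Q c) [set x0] = c 0%N.
  rewrite (@principal_perm_single _ _ x0 _ _ id) ?imset_id //.
    by rewrite big_set1 /dickson_mx /= subn0 modnn expr1.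
  move=> f fS _ u uS; have : f u \in [set x0] by rewrite -fS imset_f.
  by move: uS; rewrite !inE => /eqP-> /eqP.
rewrite -[LHS]H -[RHS]H; apply: (same_slopes_perm) => //.
apply/eqP => /setP/(_ (Ordinal n1)); rewrite !inE => /eqP.
by move/(congr1 val).
Qed.

(** * Permanents along the cycle 0 -> c -> c + 1 -> ... -> 0 *)

Section Cycle.
Variables (c : nat) (cn : (c < n)%N).
Hypothesis c_gt1 : (1 < c)%N.

(* The chord 0 -> c closes up along c -> c + 1 -> ... -> n = 0. *)
Let S : {set 'I_n} := [set u : 'I_n | (val u == 0%N) || (c <= u)%N].
Let f0 (u : 'I_n) := if val u == 0%N then Ordinal cn else shift_ord 1 u.

Lemma cycle_proper : S != setT.
Proof.
have n1 : (1 < n)%N by lia.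
by apply/eqP => /setP/(_ (Ordinal n1)); rewrite !inE /=; lia.
Qed.

Lemma modn_succ u : (u < n)%N -> ((u + 1) %% n = if u.+1 == n then 0 else u.+1)%N.
Proof.
move=> un; rewrite addn1; case: eqP => [->|H]; first by rewrite modnn.
by rewrite modn_small //; lia.
Qed.

Lemma cycle_imset : f0 @: S = S.
Proof.
apply/setP => w; apply/imsetP/idP => [[u uS ->]|].
  move: uS; rewrite !inE /f0; case: (eqVneq (val u) 0%N) => [_ _|u0].
    by rewrite /= leqnn orbT.
  by move=> /= cu; rewrite modn_succ //; case: ifP => // _; rewrite (leqW cu) orbT.
have nn : (n.-1 < n)%N by lia.
rewrite inE => /orP[/eqP w0|cw].
  exists (Ordinal nn); rewrite ?inE /f0 /=; first by lia.
  have -> : (n.-1 == 0)%N = false by lia.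
  by apply: val_inj; rewrite /= modn_succ // prednK // eqxx.
have [wc|wc] := eqVneq (val w) c.
  by exists x0; rewrite ?inE /f0 //=; apply: val_inj.
have {}wc : (c < w)%N by rewrite ltn_neqAle eq_sym cw andbT.
have wn : (w.-1 < n)%N by have := ltn_ord w; lia.
exists (Ordinal wn); rewrite ?inE /f0 /=; first by lia.
have -> : (w.-1 == 0)%N = false by lia.
by apply: val_inj; rewrite /= modn_succ // prednK ?(ltn_eqF (ltn_ord w)) //; lia.
Qed.

(** Once every vertex from c on takes its unit step, c is the only vertex of S not yet hit, and
    injectivity sends 0 there. *)
Lemma cycle_unique (f : 'I_n -> 'I_n) : f @: S = S ->
  (forall u : 'I_n, (c <= u)%N -> f u = shift_ord 1 u) ->
  forall u, u \in S -> f u = f0 u.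
Proof.
move=> fS fu u uS; rewrite /f0; case: eqP => [u0|u0]; last first.
  by apply: fu; move: uS; rewrite inE => /orP[/eqP|].
have /imset_injP f_inj : #|f @: S| == #|S| by rewrite fS.
have : f u \in S by rewrite -fS imset_f.
rewrite -{1}cycle_imset => /imsetP[w wS]; rewrite /f0.
case: eqP => // w0 fw.
have cw : (c <= w)%N by move: wS w0; rewrite inE => /orP[/eqP|].
by case: w0; rewrite -(f_inj u w) // fw fu.
Qed.

(** Rows from c on admit only the unit step, so the cycle is the sole term; row 0 is unperturbed and
    contributes the chord coefficient [a c]. *)
Lemma step_mx_cycle alpha a :
  principal_perm x0 (step_mx 1 alpha a [set u : 'I_n | (c <= u)%N]) S
    = a c * \prod_(u : 'I_n | (c <= u)%N) alpha ^+ (Q ^ u).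
Proof.
have E (u : 'I_n) : ((shift_ord 1 u + (n - u)) %% n = 1)%N.
  have un := ltn_ord u.
  rewrite /= modnDml addn1 addSnnS -subSn 1?ltnW // subnKC; last by lia.
  by rewrite -addn1 modnDl modn_small //; lia.
rewrite (principal_perm_single x0 cycle_imset) => [|f fS nz].
  rewrite (bigD1 x0) ?inE //=; congr (_ * _).
    rewrite /step_mx inE /= leqNgt (ltnW c_gt1) /=.
    by rewrite /dickson_mx /f0 /= subn0 modnDr modn_small // expr1.
  apply: eq_big => [u|u /andP[uS u0]].
    rewrite inE -val_eqE /=; case: eqP => [->|_]; last by rewrite andbT.
    by rewrite andbF leqNgt (ltnW c_gt1).
  have {}u0 : val u != 0%N by apply: contraNneq u0 => u0; apply/eqP/val_inj.
  rewrite /step_mx inE /f0 (negPf u0) E eqxx.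
  by move: uS; rewrite inE (negPf u0) /= => ->.
apply: cycle_unique => // u cu; apply/val_inj/eqP.
have uS : u \in S by rewrite inE cu orbT.
have : step_mx 1 alpha a [set u : 'I_n | (c <= u)%N] u (f u) != 0.
  by apply: contraNneq nz => z; rewrite (bigD1 u) //= z mul0r.
rewrite /step_mx inE cu; case: (_ =P 1%N) => [Ef _|]; last by rewrite eqxx.
have := diff_mod u (f u) n_gt0; rewrite !(modn_small (ltn_ord _)) Ef /= addnC => ->.
by [].
Qed.

(** Row n - 1 is left out of J, so the closing edge n - 1 -> 0 carries the coefficient at index 1.
    It is the only entry on S where a and b may differ, 1 itself being no vertex as c > 1. *)
Lemma step_mx_cycle_inj (alpha : K) a b : alpha != 0 -> a c = b c -> a c != 0 ->
  (forall l, (l < n)%N -> l != 1%N -> a l = b l) ->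
  principal_perm x0 (step_mx 1 alpha a [set u : 'I_n | (c <= u < n.-1)%N]) S =
  principal_perm x0 (step_mx 1 alpha b [set u : 'I_n | (c <= u < n.-1)%N]) S ->
  a 1%N = b 1%N.
Proof.
move=> alpha0 abc ac ab; set J := [set u : 'I_n | _].
have nn : (n.-1 < n)%N by lia.
pose um : 'I_n := Ordinal nn.
have umS : um \in S by rewrite inE /=; lia.
have E (u : 'I_n) : ((shift_ord 1 u + (n - u)) %% n = 1)%N.
  have un := ltn_ord u.
  rewrite /= modnDml addn1 addSnnS -subSn 1?ltnW // subnKC; last by lia.
  by rewrite -addn1 modnDl modn_small //; lia.
have eqm (u w : 'I_n) : u \in S -> w \in S -> (u != um) || (val w != 0%N) ->
    step_mx 1 alpha a J u w = step_mx 1 alpha b J u w.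
  move=> uS wS uw; rewrite /step_mx; case: ifP => // uJ.
  congr (_ ^+ _); apply: ab; first exact: ltn_pmod.
  apply/eqP => H; have := diff_mod u w n_gt0.
  rewrite !(modn_small (ltn_ord _)) H add1n.
  move: uS wS uw uJ; rewrite !inE -val_eqE /= => uS wS uw uJ.
  have := ltn_ord u; have := ltn_ord w => wn un.
  have [un'|un'] := eqVneq (u.+1) n; first by rewrite un' modnn => E0; move: uw; rewrite -E0; lia.
  by rewrite modn_small; lia.
move/(principal_perm_diff cycle_imset) => H.
have {H} : \prod_(u in S) step_mx 1 alpha a J u (f0 u) =
           \prod_(u in S) step_mx 1 alpha b J u (f0 u).
  apply: H => f fS [u uS fu].
  (* A permutation avoiding the edge n - 1 -> 0 sees equal entries; one using it but differing from
     the cycle breaks a unit step in J, and both products vanish. *)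
  have [fum|fum] := eqVneq (val (f um)) 0%N; last first.
    apply: eq_bigr => w wS; apply: eqm => //; first by rewrite -fS imset_f.
    by have [->|] := eqVneq w um.
  have [w wJ fw] : exists2 w, w \in J & f w != shift_ord 1 w.
    apply/exists_inP; apply: contraNT fu; rewrite negb_exists_in => /forall_inP H.
    apply/eqP; apply: cycle_unique => // w cw.
    have [->|wm] := eqVneq w um.
      by apply: val_inj; rewrite fum /= modn_succ // prednK // eqxx.
    apply/eqP; rewrite -[_ == _]negbK H // inE cw /=.
    by move: wm; rewrite -val_eqE /=; have := ltn_ord w; lia.
  have z (e : nat -> K) : \prod_(u in S) step_mx 1 alpha e J u (f u) = 0.
    rewrite (bigD1 w) /=; last by move: wJ; rewrite !inE => /andP[-> _]; rewrite orbT.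
    rewrite /step_mx wJ; case: (_ =P 1%N) => [Ef|_]; last by rewrite mul0r.
    case/eqP: fw; apply: val_inj.
    by have := diff_mod w (f w) n_gt0; rewrite !(modn_small (ltn_ord _)) Ef /= addnC => ->.
  by rewrite !z.
rewrite (bigD1 um) //= [RHS](bigD1 um) //=.
have -> : \prod_(u in S | u != um) step_mx 1 alpha b J u (f0 u) =
          \prod_(u in S | u != um) step_mx 1 alpha a J u (f0 u).
  apply: eq_bigr => u /andP[uS uum]; rewrite eqm ?uum //.
  by rewrite -cycle_imset imset_f.
have nz : \prod_(u in S | u != um) step_mx 1 alpha a J u (f0 u) != 0.
  apply/prodf_neq0 => u /andP[uS uum]; rewrite /step_mx /f0.
  move: uS uum; rewrite !inE -val_eqE /= => uS uum.
  case: (nat_of_ord u =P 0%N) => u0.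
    have -> : (c <= u < n.-1)%N = false by lia.
    by rewrite dickson_neq0 /= u0 subn0 modnDr modn_small.
  have -> : (c <= u < n.-1)%N by have := ltn_ord u; lia.
  by rewrite E eqxx expf_neq0.
move/(mulIf nz); rewrite /step_mx inE /= ltnn andbF /f0 /=.
have -> : (n.-1 == 0)%N = false by lia.
rewrite /dickson_mx E => H; apply/eqP; rewrite -subr_eq0.
have : (a 1%N - b 1%N) ^+ (Q ^ um) == 0.
  by rewrite frobD frobN H subrr.
by rewrite expf_eq0 => /andP[].
Qed.

End Cycle.

(** At R = {c + 1, ..., n} the first family has coefficient [a c] times a power of alpha. In the
    second one the rows R - d would have to lie in S, which they do not, so the coefficient is
    zero. *)
Lemma same_slopes_shift_neq a b (alpha beta : K) d : alpha != 0 -> (1 < d < n)%N ->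
  (forall s, same_slopes n Q
     (fun l => a l + (if l == 1%N then alpha * s ^+ (Q ^ 1) else 0))
     (fun l => b l + (if l == d then beta * s ^+ (Q ^ d) else 0))) ->
  forall c, (1 < c < n)%N -> a c = 0.
Proof.
move=> alpha0 dn H c /andP[c1 cn].
pose J := [set u : 'I_n | (c <= u)%N].
have := same_slopes_step_perm
  (shift_ord 1 @: J) H (cycle_proper cn c1).
have -> : shift_ord 1 @^-1: (shift_ord 1 @: J) = J.
  by apply/setP => u; rewrite inE (mem_imset _ _ (@shift_ord_inj 1)).
case: ifP => [_|/negP[]]; last by apply/subsetP => u; rewrite !inE => ->; rewrite orbT.
case: ifP => [/subsetP sub|_]; last first.
  rewrite step_mx_cycle // => /eqP; rewrite mulf_eq0 => /orP[/eqP//|].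
  by move/prodf_eq0 => [u _]; rewrite expf_eq0 (negPf alpha0) andbF.
(* The offending row is 1 if c <= d and c + 1 - d otherwise; both lie strictly between 0 and c. *)
exfalso; have [dc|dc] := leqP c d.
  have n1 : (1 < n)%N by lia.
  have d_n : (d < n)%N by lia.
  have := sub (Ordinal n1); rewrite !inE /= => /(_ _)/negP; case; last by lia.
  have -> : shift_ord d (Ordinal n1) = shift_ord 1 (Ordinal d_n).
    by apply: val_inj; rewrite /= addnC.
  by rewrite mem_imset ?inE //; exact: shift_ord_inj.
have un : (c.+1 - d < n)%N by lia.
have := sub (Ordinal un); rewrite !inE /= => /(_ _)/negP; case; last by lia.
have -> : shift_ord d (Ordinal un) = shift_ord 1 (Ordinal cn).
  by apply: val_inj; rewrite /= addn1 subnK //; lia.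
by rewrite mem_imset ?inE //; exact: shift_ord_inj.
Qed.

(** The cycle through the chord c compares the coefficients at c > 1, and a one-element S those at
    0. Index 1 is mixed with the parameter s; it is reached through a cycle whose chord coefficient
    is nonzero. *)
Lemma same_slopes_shift_eq a b (alpha : K) : alpha != 0 -> (1 < n)%N ->
  (forall s, same_slopes n Q
     (fun l => a l + (if l == 1%N then alpha * s ^+ (Q ^ 1) else 0))
     (fun l => b l + (if l == 1%N then alpha * s ^+ (Q ^ 1) else 0))) ->
  (forall l, (l < n)%N -> l != 1%N -> a l = b l) /\
  ((exists2 c, (1 < c < n)%N & a c != 0) -> a 1%N = b 1%N).
Proof.
move=> alpha0 n1 H.
have eqJ c (J : {set 'I_n}) (c1 : (1 < c)%N) (cn : (c < n)%N) :
    J \subset [set u : 'I_n | (val u == 0%N) || (c <= u)%N] ->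
    principal_perm x0 (step_mx 1 alpha a J) [set u : 'I_n | (val u == 0%N) || (c <= u)%N] =
    principal_perm x0 (step_mx 1 alpha b J) [set u : 'I_n | (val u == 0%N) || (c <= u)%N].
  move=> JS; have := same_slopes_step_perm
    (shift_ord 1 @: J) H (cycle_proper cn c1).
  have -> : shift_ord 1 @^-1: (shift_ord 1 @: J) = J.
    by apply/setP => u; rewrite inE (mem_imset _ _ (@shift_ord_inj 1)).
  by rewrite JS.
have ab l : (l < n)%N -> l != 1%N -> a l = b l.
  case: l => [_ _|[//|c] cn _].
    by have := same_slopes_coef0 n1 (H 0); rewrite !addr0.
  have JS : [set u : 'I_n | (c.+2 <= u)%N] \subset
      [set u : 'I_n | (val u == 0%N) || (c.+2 <= u)%N].
    by apply/subsetP => u; rewrite !inE => ->; rewrite orbT.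
  have := eqJ c.+2 _ isT cn JS; rewrite !step_mx_cycle //; apply: mulIf.
  by apply/prodf_neq0 => u _; rewrite expf_neq0.
split=> // -[c /andP[c1 cn] ac].
apply: (@step_mx_cycle_inj c cn c1 alpha a b) => //.
  by apply: ab => //; lia.
by apply: eqJ => //; apply/subsetP => u; rewrite !inE => /andP[-> _]; rewrite orbT.
Qed.

Lemma eq_lin_poly a b t : (forall l, (l < n)%N -> a l = b l) ->
  lin_poly n Q a t = lin_poly n Q b t.
Proof. by move=> ab; apply: eq_bigr => l _; rewrite ab. Qed.

Lemma lin_poly_add a b t :
  lin_poly n Q (fun l => a l + b l) t = lin_poly n Q a t + lin_poly n Q b t.
Proof. by rewrite -big_split; apply: eq_bigr => l _ /=; rewrite mulrDl. Qed.

Lemma frob_surj (x : K) : exists y, y ^+ Q = x.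
Proof.
exists (x ^+ (Q ^ n.-1)); rewrite -exprM -expnSr prednK // -frob_mod modnn.
by rewrite expn0 expr1.
Qed.

(** * Graphs with the same slopes on every line through a point *)

Section Graphs.
Variables (m : nat) (alpha : K) (A B : 'I_m -> nat -> K) (b0 : nat -> K).
Hypothesis alpha0 : alpha != 0.
Let fU (x : K) (z : 'I_m -> K) := alpha * x ^+ Q + \sum_k lin_poly n Q (A k) (z k).
Let fW (x : K) (z : 'I_m -> K) := lin_poly n Q b0 x + \sum_k lin_poly n Q (B k) (z k).
Hypothesis slopesUW : forall x z v,
  (exists2 t, t != 0 & fU (t * x) (fun k => t * z k) = t * v) <->
  (exists2 t, t != 0 & fW (t * x) (fun k => t * z k) = t * v).

Lemma sum_lin_poly_set (C : 'I_m -> nat -> K) (D : {set 'I_m}) t :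
  \sum_k lin_poly n Q (C k) (t * (k \in D)%:R)
    = lin_poly n Q (fun l => \sum_(k in D) C k l) t.
Proof.
rewrite [LHS](bigID (mem D)) /= [X in _ + X]big1 ?addr0 => [|k /negPf->]; last first.
  by rewrite mulr0 lin_poly0.
rewrite /lin_poly.
rewrite (eq_bigr (fun k => \sum_(l < n) C k l * t ^+ (Q ^ l))) => [|k ->]; last first.
  by rewrite mulr1.
by rewrite exchange_big /=; apply: eq_bigr => l _; rewrite mulr_suml.
Qed.

Lemma lin_poly_delta_mul d (beta s t : K) : (d < n)%N ->
  lin_poly n Q (fun l => if l == d then beta * s ^+ (Q ^ d) else 0) t =
  beta * (t * s) ^+ (Q ^ d).
Proof. by move=> dn; rewrite lin_poly_delta // exprMn mulrAC mulrA. Qed.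

(** Only the coefficients at 0 and 1 survive. Dividing the latter by alpha and taking Q-th roots
    moves it inside the power of x, by additivity of x^Q; the former is the linear part [beta]. *)
Lemma graph_cone : (forall k c, (1 < c < n)%N -> A k c = 0) ->
  exists eta beta : 'I_m -> K, forall x z,
    fU x z = alpha * (x + \sum_k eta k * z k) ^+ Q + \sum_k beta k * z k.
Proof.
move=> A0; have [n1|] := leqP n 1.
  have n_1 : n = 1%N by lia.
  exists (fun=> 0), (fun k => A k 0%N) => x z; congr (_ + _).
    by rewrite big1 ?addr0 // => k _; rewrite mul0r.
  apply: eq_bigr => k _; rewrite /lin_poly n_1 big_ord_recl big_ord0 addr0.
  by rewrite expr1.
move=> n1.
have etaP k : exists y, y ^+ Q == A k 1%N / alpha.
  by have [y <-] := frob_surj (A k 1%N / alpha); exists y.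
exists (fun k => xchoose (etaP k)), (fun k => A k 0%N) => x z.
have fD (u v : K) : (u + v) ^+ Q = u ^+ Q + v ^+ Q.
  by have := frobD 1 u v; rewrite expn1.
have -> : (x + \sum_k xchoose (etaP k) * z k) ^+ Q =
    x ^+ Q + \sum_k A k 1%N / alpha * z k ^+ Q.
  rewrite fD; congr (_ + _); have := frob_sum 1.
  rewrite expn1 => ->; apply: eq_bigr => k _; rewrite exprMn.
  by rewrite (eqP (xchooseP (etaP k))).
rewrite mulrDr -addrA; congr (_ + _); rewrite mulr_sumr -big_split /=.
apply: eq_bigr => k _; rewrite /lin_poly.
rewrite (bigD1 (Ordinal n_gt0)) //= (bigD1 (Ordinal n1)) //= big1 ?addr0.
  by rewrite expr1 expn1 addrC mulrA [alpha * _]mulrC divfK.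
move=> l /andP[l0 l1]; rewrite A0 ?mul0r //.
by move: l0 l1; rewrite -!val_eqE /=; have := ltn_ord l; lia.
Qed.

Lemma graph_dichotomy :
  (exists2 lambda, lambda != 0 &
     forall x z, fW (lambda * x) (fun k => lambda * z k) = lambda * fU x z) \/
  (exists eta beta : 'I_m -> K, forall x z,
     fU x z = alpha * (x + \sum_k eta k * z k) ^+ Q + \sum_k beta k * z k).
Proof.
pose deg k := [forall c : 'I_n, (1 < c)%N ==> (A k c == 0)].
have degP k : deg k -> forall c, (1 < c < n)%N -> A k c = 0.
  move=> /forallP H c /andP[c1 cn].
  by have := H (Ordinal cn); rewrite /= c1 => /eqP.
have [/forallP alldeg|] := boolP [forall k, deg k].
  by right; apply: graph_cone => k; exact: degP.
rewrite negb_forall => /existsP[k0 ndeg]; left.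
have [c0 c0n Ac0] : exists2 c0, (1 < c0 < n)%N & A k0 c0 != 0.
  move: ndeg; rewrite negb_forall => /existsP[c]; rewrite negb_imply => /andP[c1 Ac].
  by exists (val c); rewrite ?c1 ?ltn_ord.
have n1 : (1 < n)%N by lia.
have n1m : (1 %% n = 1)%N by rewrite modn_small.
have frob1 (x : K) : x ^+ (Q ^ 1) = x ^+ Q by rewrite expn1.
have slopes0 : same_slopes n Q b0 (fun l => if l == (1 %% n)%N then alpha else 0).
  move=> v; have := slopesUW 1 (fun=> 0) v.
  have EU t : fU (t * 1) (fun=> t * 0) =
      lin_poly n Q (fun l => if l == (1 %% n)%N then alpha else 0) t.
    rewrite n1m lin_poly_delta // frob1 /fU mulr1 big1 ?addr0 // => k _.
    by rewrite mulr0 lin_poly0.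
  have EW t : fW (t * 1) (fun=> t * 0) = lin_poly n Q b0 t.
    rewrite /fW mulr1 big1 ?addr0 // => k _.
    by rewrite mulr0 lin_poly0.
  case=> UW WU; split=> -[t t0 Ht].
    have [|s s0 Hs] := WU; first by exists t; rewrite ?EW.
    by exists s; rewrite -?EU.
  have [|s s0 Hs] := UW; first by exists t; rewrite ?EU.
  by exists s; rewrite -?EW.
have [d [dn cop b0d b0z]] := same_slopes_monomial alpha0 slopes0.
set beta := b0 d in b0d.
have b0E x : lin_poly n Q b0 x = beta * x ^+ (Q ^ d).
  rewrite -(lin_poly_delta beta x dn); apply: eq_lin_poly => l ln.
  by case: eqP => [->|/eqP ld] //; exact: b0z.
have EU (D : {set 'I_m}) s t : fU (t * s) (fun k => t * (k \in D)%:R) =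
    lin_poly n Q (fun l => \sum_(k in D) A k l +
      (if l == 1%N then alpha * s ^+ (Q ^ 1) else 0)) t.
  by rewrite lin_poly_add lin_poly_delta_mul // frob1 addrC -(sum_lin_poly_set A D t).
have EW (D : {set 'I_m}) s t : fW (t * s) (fun k => t * (k \in D)%:R) =
    lin_poly n Q (fun l => \sum_(k in D) B k l +
      (if l == d then beta * s ^+ (Q ^ d) else 0)) t.
  by rewrite lin_poly_add lin_poly_delta_mul // addrC -(sum_lin_poly_set B D t) /fW b0E.
(* Lines with x = t s and z equal to t on D and 0 elsewhere: s is the free parameter, while D adds
   up the polynomials of its coordinates. *)
have slopesD (D : {set 'I_m}) s : same_slopes n Q
    (fun l => \sum_(k in D) A k l + (if l == 1%N then alpha * s ^+ (Q ^ 1) else 0))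
    (fun l => \sum_(k in D) B k l + (if l == d then beta * s ^+ (Q ^ d) else 0)).
  move=> v; have [UW WU] := slopesUW s (fun k => (k \in D)%:R) v.
  split=> -[t t0 Ht].
    have [|t' t'0 Ht'] := UW; first by exists t; rewrite ?EU.
    by exists t'; rewrite -?EW.
  have [|t' t'0 Ht'] := WU; first by exists t; rewrite ?EW.
  by exists t'; rewrite -?EU.
have d0 : (0 < d)%N.
  by case: (posnP d) cop => // ->; rewrite /coprime gcd0n => /eqP; lia.
(* A different Frobenius exponent in W would annihilate all coefficients of [A k0] past index 1,
   among them the one at [c0]. *)
have d1 : d = 1%N.
  apply/eqP; apply: contraNT Ac0 => dn1; apply/eqP.
  have d1n : (1 < d < n)%N by lia.
  have := same_slopes_shift_neq alpha0 d1n (slopesD [set k0]) c0n.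
  by rewrite big_set1.
(* The slope alpha of U is attained by W at some t. This t is the scalar lambda, since beta t^Q = t
   alpha turns beta into alpha after rescaling. *)
have [t t0 tE] : exists2 t, t != 0 & beta * t ^+ Q = t * alpha.
  have [_ []] := slopes0 alpha.
    by exists 1; rewrite ?oner_neq0 // lin_poly_delta ?n1m // expr1n mulr1 mul1r.
  by move=> t t0; rewrite b0E d1 frob1; exists t.
exists t => //.
(* These are the coefficients of x -> t^-1 f(t x), which describes the graph t^-1 W. *)
pose B' k l := t^-1 * (B k l * t ^+ (Q ^ l)).
have B'E k z : lin_poly n Q (B k) (t * z) = t * lin_poly n Q (B' k) z.
  rewrite /lin_poly mulr_sumr; apply: eq_bigr => l _.
  by rewrite exprMn /B' -!mulrA mulVKf.
have sB' (D : {set 'I_m}) s l :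
    \sum_(k in D) B' k l + (if l == 1%N then alpha * s ^+ (Q ^ 1) else 0) =
    t^-1 * ((\sum_(k in D) B k l + (if l == d then beta * s ^+ (Q ^ d) else 0)) * t ^+ (Q ^ l)).
  rewrite mulrDl mulrDr mulr_suml mulr_sumr d1; congr (_ + _).
  case: eqP => [->|_]; last by rewrite mul0r mulr0.
  by rewrite !frob1 mulrAC tE mulrA mulKf.
have lpB' (D : {set 'I_m}) s x : lin_poly n Q (fun l => \sum_(k in D) B' k l +
     (if l == 1%N then alpha * s ^+ (Q ^ 1) else 0)) x = t^-1 * lin_poly n Q (fun l =>
     \sum_(k in D) B k l + (if l == d then beta * s ^+ (Q ^ d) else 0)) (t * x).
  rewrite /lin_poly mulr_sumr; apply: eq_bigr => l _.
  by rewrite sB' exprMn -!mulrA.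
have slopesB' (D : {set 'I_m}) s : same_slopes n Q
    (fun l => \sum_(k in D) A k l + (if l == 1%N then alpha * s ^+ (Q ^ 1) else 0))
    (fun l => \sum_(k in D) B' k l + (if l == 1%N then alpha * s ^+ (Q ^ 1) else 0)).
  move=> v; have [UW WU] := slopesD D s v; split=> [/UW|] [y y0 Hy].
    exists (t^-1 * y); first by rewrite mulf_neq0 ?invr_neq0.
    by rewrite lpB' mulVKf // Hy mulrA.
  apply: WU; exists (t * y); first by rewrite mulf_neq0.
  by move: Hy; rewrite lpB' -mulrA => <-; rewrite mulVKf.
have eqA D := same_slopes_shift_eq alpha0 n1 (slopesB' D).
have AB k l : (l < n)%N -> A k l = B' k l.
  move=> ln; have [ne1 eq1] := eqA [set k].
  have [->|l1] := eqVneq l 1%N; last by have := ne1 l ln l1; rewrite !big_set1.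
  have [dk|ndk] := boolP (deg k); last first.
    move: eq1; rewrite !big_set1; apply.
    move: ndk; rewrite negb_forall => /existsP[c]; rewrite negb_imply => /andP[c1 Ac].
    by exists (val c); rewrite ?big_set1 ?c1 ?ltn_ord.
  (* When [A k] has no nonzero coefficient past index 1, the pair {k0, k} borrows one from k0: the
     sum at [c0] stays nonzero, and subtracting the equality for k0 gives that for k. *)
  have kk0 : k0 != k by apply: contraNneq ndeg => ->.
  have [_ ] := eqA [set k0; k].
  have sum2 (C : 'I_m -> nat -> K) e : \sum_(j in [set k0; k]) C j e = C k0 e + C k e.
    by rewrite big_setU1 ?inE // big_set1.
  rewrite !sum2 => eq2.
  have [_ ] := eqA [set k0]; rewrite !big_set1 => eq0.
  have E0 : A k0 1%N = B' k0 1%N by apply: eq0; exists c0; rewrite ?big_set1.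
  have : A k0 1%N + A k 1%N = B' k0 1%N + B' k 1%N.
    by apply: eq2; exists c0 => //; rewrite sum2 (degP _ dk) // addr0.
  by rewrite E0 => /addrI.
move=> x z; rewrite /fW /fU b0E d1 frob1 exprMn mulrA tE mulrDr mulrA; congr (_ + _).
rewrite mulr_sumr; apply: eq_bigr => k _; rewrite B'E; congr (_ * _).
by apply: eq_lin_poly => l ln; rewrite AB.
Qed.

End Graphs.

(** The coefficients are placed on singletons, proper subsets once n > 1, so independence of the
    multilinear monomials applies. *)
Lemma lin_poly_eq0 (a : nat -> K) : (forall t, lin_poly n Q a t = 0) ->
  forall l, (l < n)%N -> a l = 0.
Proof.
move=> a0 l ln; have [n1|n1] := leqP n 1.
  have := a0 1; rewrite /lin_poly (bigD1 (Ordinal ln)) //= expr1n mulr1 big1 ?addr0 //.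
  by move=> k; rewrite -val_eqE /=; have := ltn_ord k; lia.
pose c (R : {set 'I_n}) := \sum_(w | R == [set w]) a w.
have cE w : c [set w] = a w.
  rewrite /c (eq_bigl (pred1 w)) ?big_pred1_eq // => u.
  by rewrite (inj_eq set1_inj) eq_sym.
rewrite -(cE (Ordinal ln)).
apply: (multilinear_frob_inj) => [|s].
  apply: big1 => w /eqP/(congr1 (fun X : {set _} => #|X|)).
  by rewrite cardsT card_ord cards1; lia.
rewrite -[RHS](a0 s).
transitivity (\sum_(R : {set 'I_n}) \sum_(w | R == [set w]) a w * s ^+ (Q ^ w)).
  apply: eq_bigr => R _; rewrite mulr_suml; apply: eq_bigr => w /eqP ->.
  by rewrite big_set1.
rewrite (exchange_big_dep predT) //=; apply: eq_bigr => w _.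
by rewrite big_pred1_eq.
Qed.

End FiniteField.

(** * Subspaces of L^r as graphs *)

Lemma exists_frob_fixed (K : finFieldType) q n d : (0 < n)%N -> #|K| = (q ^ n)%N ->
  (d %| n)%N -> (1 < d)%N ->
  exists2 y : K, y ^+ (q ^ d) = y & y ^+ q != y.
Proof.
move=> n_gt0 cardK dn d1; have q1 := base_gt1 n_gt0 cardK.
have /cyclicP[g gE] : cyclic [set: {unit K}] by exact: field_unit_group_cyclic.
have og : #[g]%g = (q ^ n).-1 by rewrite orderE -gE card_finField_unit cardK.
have qd : (q < q ^ d)%N by rewrite -{1}[q]expn1 ltn_exp2l.
have dv : ((q ^ d).-1 %| (q ^ n).-1)%N.
  by rewrite -(divnK dn) mulnC expnM dvdn_pred_predX.
pose e := ((q ^ n).-1 %/ (q ^ d).-1)%N; pose y := (g ^+ e)%g.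
have oy : #[y]%g = (q ^ d).-1.
  have eE : (e * (q ^ d).-1 = (q ^ n).-1)%N by rewrite divnK.
  have qn : (1 < q ^ n)%N by rewrite -cardK finNzRing_gt1.
  by rewrite orderXdiv og -eE ?dvdn_mulr // mulKn //; case: (e) eE => //; lia.
exists (val y); rewrite -?val_unitX; first congr val.
  rewrite -[X in (_ ^+ X)%g]prednK ?expn_gt0 ?(ltnW q1) // expgS -oy.
  by rewrite expg_order mulg1.
rewrite (inj_eq val_inj) -[X in (_ ^+ X)%g](prednK (ltnW q1)) expgS.
rewrite -[X in _ == X]mulg1 (inj_eq (mulgI y)) -order_dvdn oy.
by apply/negP => /dvdn_leq; lia.
Qed.

Lemma lfun_of_linear (F : fieldType) (V1 V2 : vectType F) (f : V1 -> V2) :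
  linear f -> exists g : 'Hom(V1, V2), g =1 f.
Proof.
move=> lf.
pose g : {linear V1 -> V2} := HB.pack f (GRing.isLinear.Build F V1 V2 _ f lf).
by exists (linfun g) => x; rewrite lfunE.
Qed.

(** * Linear maps of the extension field as linearized polynomials *)

Section Ext.
Variables (F : finFieldType) (L : fieldExtType F).
Local Notation n := (\dim {:L}).
Local Notation q := #|F|.
Local Notation K := (FinFieldExtType L).

Lemma ext_dim_gt0 : (0 < n)%N. Proof. exact: adim_gt0. Qed.

Lemma ext_card : #|K| = (q ^ n)%N.
Proof.
transitivity #|({: finvect_type L} : {vspace (finvect_type L)})%VS|.
  by apply: eq_card => x; rewrite memvf.
exact: card_vspace.
Qed.

Lemma ext_char : [pchar K].-nat q.
Proof.
have [p p_pr pF] := finPcharP F.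
have pL : p \in [pchar K] by rewrite -(pchar_lalg L) in pF.
have pq : p.-nat q by rewrite -cardsT; exact: (pprimeChar_pgroup pF).
by rewrite (eq_pnat _ (pcharf_eq pL)).
Qed.

Lemma frobZ e (c : F) (x : L) : (c *: x) ^+ (q ^ e) = c *: x ^+ (q ^ e).
Proof.
rewrite exprZn; congr (_ *: _).
by elim: e => [|e IHe]; rewrite ?expr1 // expnSr exprM IHe expf_card.
Qed.

Lemma frob_linear e (a : L) : linear (fun x : L => a * x ^+ (q ^ e)).
Proof.
move=> c x y; have := frobD e ext_char 1 (c *: x) y; rewrite expn1 => ->.
by rewrite frobZ mulrDr -scalerAr.
Qed.

Lemma lin_poly_linear i (a : nat -> L) : linear (lin_poly n (q ^ i) a).
Proof.
move=> c x y; rewrite /lin_poly scaler_sumr -big_split; apply: eq_bigr => l _ /=.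
by rewrite -expnM frob_linear.
Qed.

(** Interpolation on an F_q-basis: the Moore matrix [N] of the Q-powers of the basis is invertible,
    because a nonzero left kernel vector would give a nonzero linearized polynomial vanishing
    identically. *)
Lemma linear_lin_poly i (f : L -> L) : coprime i n -> linear f ->
  exists a, f =1 lin_poly n (q ^ i) a.
Proof.
move=> cop lf; have [g gf] := lfun_of_linear lf.
pose X := vbasis {:L}.
have ext (h1 h2 : 'End(L)) : (forall j : 'I_n, h1 X`_j = h2 X`_j) -> h1 =1 h2.
  move=> H x; rewrite (coord_vbasis (memvf x)) !linear_sum; apply: eq_bigr => j _.
  by rewrite !linearZ /= H.
pose N : 'M[L]_n := \matrix_(l, j) X`_j ^+ ((q ^ i) ^ l).
have NE (c : 'rV[L]_n) : exists2 a : nat -> L, (forall l : 'I_n, a l = c 0 l) &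
    forall j, (c *m N) 0 j = lin_poly n (q ^ i) a X`_j.
  exists (fun l => if insub l is Some l' then c 0 l' else 0) => [l|j].
    by rewrite valK.
  by rewrite mxE; apply: eq_bigr => l _; rewrite valK mxE.
have NU : N \in unitmx.
  rewrite -row_free_unit -kermx_eq0; apply/rowV0P => c /sub_kermxP cN.
  have [a ac aN] := NE c; have [h hE] := lfun_of_linear (lin_poly_linear i a).
  have h0 : h =1 (0 : 'End(L)).
    by apply: ext => j; rewrite hE -aN cN mxE lfunE.
  apply/rowP => l; rewrite mxE -ac.
  have a0 t : lin_poly n (q ^ i) a t = 0 by rewrite -[LHS]hE h0 lfunE.
  exact (@lin_poly_eq0 K q n i ext_dim_gt0 ext_card ext_char cop a a0 l (ltn_ord l)).
have [a ac aN] := NE ((\row_j g X`_j) *m invmx N).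
have [h hE] := lfun_of_linear (lin_poly_linear i a).
exists a => x; rewrite -gf -hE; apply: ext => j.
by rewrite hE -aN mulmxKV // mxE.
Qed.

End Ext.

(** * Scalars, spans and graphs over the extension field *)

Section Space.
Variables (F : finFieldType) (L : fieldExtType F) (r : nat).
Local Notation V := (Vr L r).
Local Notation n := (\dim {:L}).
Local Notation q := #|F|.
Implicit Types (v w : V) (x y t : L).

Lemma LscaleDl x y v : Lscale (x + y) v = Lscale x v + Lscale y v.
Proof. by apply/ffunP => j; rewrite !ffunE mulrDl. Qed.

Lemma LscaleDr x v w : Lscale x (v + w) = Lscale x v + Lscale x w.
Proof. by apply/ffunP => j; rewrite !ffunE mulrDr. Qed.

Lemma LscaleA x y v : Lscale x (Lscale y v) = Lscale (x * y) v.
Proof. by apply/ffunP => j; rewrite !ffunE mulrA. Qed.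

Lemma Lscale1 v : Lscale 1 v = v.
Proof. by apply/ffunP => j; rewrite !ffunE mul1r. Qed.

Lemma Lscale0l v : Lscale 0 v = 0.
Proof. by apply/ffunP => j; rewrite !ffunE mul0r. Qed.

Lemma Lscale0r x : Lscale x (0 : V) = 0.
Proof. by apply/ffunP => j; rewrite !ffunE mulr0. Qed.

Lemma LscaleNl x v : Lscale (- x) v = - Lscale x v.
Proof. by apply/ffunP => j; rewrite !ffunE mulNr. Qed.

Lemma LscaleZl (c : F) x v : Lscale (c *: x) v = c *: Lscale x v.
Proof. by apply/ffunP => j; rewrite !ffunE scalerAl. Qed.

Lemma Lscale_sumr x (I : finType) (P : pred I) (f : I -> V) :
  Lscale x (\sum_(k | P k) f k) = \sum_(k | P k) Lscale x (f k).
Proof.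
by apply: (big_morph (Lscale x)) => [v w|]; [exact: LscaleDr|exact: Lscale0r].
Qed.

Lemma LscaleI x v w : x != 0 -> Lscale x v = Lscale x w -> v = w.
Proof.
by move=> x0 /(congr1 (Lscale x^-1)); rewrite !LscaleA mulVf // !Lscale1.
Qed.

Lemma Lcomb_linear k (b : 'I_k -> V) :
  linear (fun c : {ffun 'I_k -> L} => Lcomb c b).
Proof.
move=> c u w; rewrite /Lcomb scaler_sumr -big_split; apply: eq_bigr => j _ /=.
by rewrite !ffunE LscaleDl LscaleZl.
Qed.

Lemma Lspan_exists k (b : 'I_k -> V) : exists S : {vspace V},
  forall v, v \in S <-> exists c : 'I_k -> L, v = Lcomb c b.
Proof.
have [g gE] := lfun_of_linear (Lcomb_linear b).
exists (limg g) => v; split=> [/memv_imgP[c _ ->]|[c ->]].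
  by exists c; rewrite gE.
suff -> : Lcomb c b = g [ffun j => c j] by exact: memv_img (memvf _).
by rewrite gE; apply: eq_bigr => j _; rewrite ffunE.
Qed.

Lemma dim_ffun (k : nat) (vT : vectType F) : \dim {: {ffun 'I_k -> vT}} = (k * \dim {: vT})%N.
Proof. by rewrite !dimvf /dim /= card_ord. Qed.

Lemma LsubspaceDim_dim (S : {vspace V}) k : LsubspaceDim S k -> \dim S = (k * n)%N.
Proof.
case=> b [bI bS]; have [g gE] := lfun_of_linear (Lcomb_linear b).
have -> : S = limg g.
  apply/vspaceP => v; apply/idP/memv_imgP => [/bS[c ->]|[c _ ->]].
    exists [ffun j => c j]; first exact: memvf.
    by rewrite gE; apply: eq_bigr => j _; rewrite ffunE.
  by apply/bS; exists c; rewrite gE.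
rewrite limg_dim_eq ?dim_ffun //; apply/eqP; rewrite -subv0; apply/subvP => c.
rewrite memv_cap memvf memv_ker gE => /eqP c0; rewrite memv0; apply/eqP/ffunP => j.
by rewrite ffunE; exact: (bI c).
Qed.

Lemma LsubspaceDim_scale (S : {vspace V}) k x v :
  LsubspaceDim S k -> v \in S -> Lscale x v \in S.
Proof.
case=> b [_ bS] /bS[c ->]; apply/bS; exists (fun j => x * c j).
by rewrite /Lcomb Lscale_sumr; apply: eq_bigr => j _; rewrite LscaleA.
Qed.

Lemma complete_basis (v0 v1 : V) :
  (forall x y, Lscale x v0 + Lscale y v1 = 0 -> x = 0 /\ y = 0) ->
  exists m (w : 'I_m -> V), [/\ r = m.+2,
    forall v, exists x y (z : 'I_m -> L), v = Lscale x v0 + Lscale y v1 + Lcomb z w &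
    forall x y (z : 'I_m -> L), Lscale x v0 + Lscale y v1 + Lcomb z w = 0 ->
      [/\ x = 0, y = 0 & forall k, z k = 0]].
Proof.
move=> ind.
pose rowv v : 'rV[L]_r := \row_j v j.
pose M : 'M[L]_(1 + 1, r) := col_mx (rowv v0) (rowv v1).
have Mmul (a b : 'M_1) : row_mx a b *m M =
    rowv (Lscale (a 0 0) v0 + Lscale (b 0 0) v1).
  rewrite mul_row_col; apply/rowP => j; rewrite !mxE !big_ord1 !mxE !ffunE.
  by [].
have Mfree : row_free M.
  rewrite -kermx_eq0; apply/rowV0P => c /sub_kermxP.
  rewrite -[c]hsubmxK Mmul => H.
  have /ind[H0 H1] : Lscale (lsubmx c 0 0) v0 + Lscale (rsubmx c 0 0) v1 = 0.
    by apply/ffunP => j; move/rowP/(_ j): H; rewrite !mxE !ffunE.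
  rewrite -(row_mx0 L 1 1 1); congr row_mx; apply/matrixP => j k.
    by rewrite !ord1 H0 mxE.
  by rewrite !ord1 H1 mxE.
pose C := row_base (M^C)%MS; pose m := \rank (M^C)%MS.
have rM : \rank M = 2%N by apply/eqP.
have r2 : (2 <= r)%N by rewrite -rM rank_leq_col.
have rm : r = m.+2 by have := mxrank_compl M; rewrite -/m rM; lia.
pose w (k : 'I_m) : V := [ffun j => C k j].
have Cmul (c : 'rV_m) : c *m C = rowv (Lcomb (fun k => c 0 k) w).
  apply/rowP => j; rewrite !mxE sum_ffunE; apply: eq_bigr => k _.
  by rewrite !ffunE.
pose N := col_mx M C.
have Nfull : row_full N.
  rewrite -sub1mx; apply: submx_trans (_ : (1%:M <= M + M^C)%MS) _.
    by rewrite sub1mx addsmx_compl_full.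
  rewrite -addsmxE addsmxS //; by rewrite eq_row_base.
have Nfree : row_free N by apply/eqP; rewrite (eqP Nfull).
exists m, w; split=> // [v|x y z H].
  have /submxP[c vc] : (rowv v <= N)%MS by rewrite submx_full.
  exists (lsubmx (lsubmx c) 0 0), (rsubmx (lsubmx c) 0 0), (fun k => rsubmx c 0 k).
  apply/ffunP => j; move/rowP/(_ j): vc; rewrite mxE => ->.
  rewrite -[c in LHS]hsubmxK mul_row_col -[lsubmx c in LHS]hsubmxK Mmul Cmul.
  by rewrite !mxE !ffunE.
pose c : 'rV_(1 + 1 + m) := row_mx (row_mx x%:M y%:M) (\row_k z k).
have : c *m N = 0.
  rewrite mul_row_col Mmul Cmul (_ : Lcomb _ w = Lcomb z w); last first.
    by apply: eq_bigr => k _; rewrite mxE.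
  apply/rowP => j.
  by move/ffunP/(_ j): H; rewrite !mxE !ffunE => <-.
rewrite -(mul0mx _ N) => /(row_free_inj Nfree) c0.
have := congr1 (@lsubmx _ _ _ _) c0; have := congr1 (@rsubmx _ _ _ _) c0.
rewrite row_mxKl row_mxKr !raddf0 => z0 xy0.
have := congr1 (@lsubmx _ _ _ _) xy0; have := congr1 (@rsubmx _ _ _ _) xy0.
rewrite row_mxKl row_mxKr !raddf0 => /matrixP/(_ 0 0) y0 /matrixP/(_ 0 0) x0'.
rewrite !mxE eqxx mulr1n in y0 x0'; split=> // k.
by move/rowP/(_ k): z0; rewrite !mxE.
Qed.

Lemma Lscale_suml (I : finType) (f : I -> L) v :
  Lscale (\sum_k f k) v = \sum_k Lscale (f k) v.
Proof.
apply/ffunP => j; rewrite ffunE sum_ffunE mulr_suml; apply: eq_bigr => k _.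
by rewrite ffunE.
Qed.

(** For d = gcd(i, n) > 1 the elements fixed by x -> x^(q^d) form a subfield larger than F_q, and
    they are also fixed by x -> x^(q^i); so the pseudoregulus subspace is linear over that subfield,
    against maximality. *)
Lemma maxField_coprime (P : V -> Prop) v0 v1 i :
  PSetEq P (LinSet (fun u => exists mu : L,
    u = Lscale mu v0 + Lscale (mu ^+ (q ^ i)) v1)) ->
  maxFieldLinearity_q P -> coprime i n.
Proof.
move=> PE maxP; apply: contraT => ncop; exfalso.
pose d := gcdn i n; have n0 := ext_dim_gt0 L.
have d1 : (1 < d)%N.
  have : (0 < d)%N by rewrite gcdn_gt0 n0 orbT.
  by move: ncop; rewrite /coprime -/d; case: d => [|[|]].
have [y yd yq] := exists_frob_fixed n0 (ext_card L) (dvdn_gcdr i n) d1.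
have lphi : linear (fun x : L => x ^+ (q ^ d) - x).
  move=> c x z; have := frob_linear d 1 c x z; rewrite !mul1r => ->.
  by rewrite scalerBr opprD addrACA.
have [phi phiE] := lfun_of_linear lphi.
have inK x : (x \in lker phi) = (x ^+ (q ^ d) == x).
  by rewrite memv_ker phiE subr_eq0.
have K1 : 1 \in lker phi by rewrite inK expr1n.
have Kas : is_aspace (lker phi).
  apply/andP; split; first exact: has_algid1.
  apply/prodvP => x z; rewrite !inK exprMn => /eqP-> /eqP->; exact: eqxx.
pose K0 : {subfield L} := ASpace Kas.
have lg : linear (fun mu : L => Lscale mu v0 + Lscale (mu ^+ (q ^ i)) v1).
  move=> c x z; have := frob_linear i 1 c x z; rewrite !mul1r => ->.
  by rewrite !LscaleDl !LscaleZl scalerDr addrACA.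
have [g gE] := lfun_of_linear lg.
apply: (maxP K0 (limg g)).
- rewrite ltnNge; apply/negP => dimK.
  have /eqP E : (1%VS == lker phi)%VS.
    by rewrite eqEdim -memvE K1 dimv1.
  have : y \in 1%VS by rewrite E inK; apply/eqP.
  case/vlineP => c yc; case/eqP: yq; rewrite yc.
  by have := frobZ 1 c (1 : L); rewrite expn1 expr1n.
- move=> k v kK /memv_imgP[mu _ ->]; rewrite gE LscaleDr !LscaleA.
  have kd : k ^+ (q ^ d) = k by apply/eqP; rewrite -inK.
  have ki : k ^+ (q ^ i) = k.
    rewrite -(divnK (dvdn_gcdl i n)) mulnC expnM.
    by elim: (i %/ _)%N => [|e IHe]; rewrite ?expr1 // expnSr exprM IHe.
  by rewrite -{2}ki -exprMn -(gE (k * mu)) memv_img ?memvf.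
move=> v; apply: (iff_trans (PE v)).
split=> -[v0' [l [l0 Hl]]]; split=> //; exists l; split=> //.
  by have [mu ->] := Hl; rewrite /inVS -gE memv_img ?memvf.
by have /memv_imgP[mu _ ->] := Hl; exists mu; rewrite gE.
Qed.

Section Graph.
Variables (U : {vspace V}) (v1 : V).
Hypothesis U_v1 : forall y, Lscale y v1 \in U -> y = 0.

Lemma graph_uniq v y y' :
  v + Lscale y v1 \in U -> v + Lscale y' v1 \in U -> y = y'.
Proof.
move=> Uy Uy'; apply/eqP; rewrite -subr_eq0; apply/eqP/U_v1.
have := memvB Uy Uy'; rewrite opprD addrACA subrr add0r LscaleDl LscaleNl.
by [].
Qed.

Lemma graph_total : (0 < r)%N -> \dim U = ((r - 1) * n)%N ->
  forall v, exists y, v + Lscale y v1 \in U.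
Proof.
move=> r0 dU; have [S SE] := Lspan_exists (fun _ : 'I_1 => v1).
have {}SE v : v \in S <-> exists x, v = Lscale x v1.
  apply: (iff_trans (SE v)); split=> [[c ->]|[x ->]].
    by exists (c 0); rewrite /Lcomb big_ord1.
  by exists (fun=> x); rewrite /Lcomb big_ord1.
have dS : \dim S = (1 * n)%N.
  apply: LsubspaceDim_dim; exists (fun=> v1); split=> [c|v].
    rewrite /Lcomb big_ord1 => c0 j; rewrite ord1; apply: U_v1.
    by rewrite c0 mem0v.
  apply: (iff_trans (SE v)); split=> [[x ->]|[c ->]].
    by exists (fun=> x); rewrite /Lcomb big_ord1.
  by exists (c 0); rewrite /Lcomb big_ord1.
have US : (U :&: S = 0)%VS.
  apply/eqP; rewrite -subv0; apply/subvP => v; rewrite memv_cap => /andP[vU].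
  by case/SE => x vx; move: vU; rewrite vx memv0 => /U_v1 ->; rewrite Lscale0l.
have full : (U + S)%VS = fullv.
  apply/eqP; rewrite eqEdim subvf dimv_disjoint_sum // dU dS dim_ffun -mulnDl.
  by rewrite subnK ?leqnn.
move=> v; have : v \in (U + S)%VS by rewrite full memvf.
case/memv_addP => u uU [s /SE[x ->] ->]; exists (- x).
by rewrite LscaleNl addrK.
Qed.

(** The height of U above x v is unique, hence F_q-linear in x, hence a linearized polynomial in the
    chosen Q. *)
Lemma graph_coord i : coprime i n -> (forall v, exists y, v + Lscale y v1 \in U) ->
  forall v, exists a, forall x,
    Lscale x v + Lscale (lin_poly n (q ^ i) a x) v1 \in U.
Proof.
move=> cop tot v; pose f x := xchoose (tot (Lscale x v)).
have fP x : Lscale x v + Lscale (f x) v1 \in U := xchooseP (tot (Lscale x v)).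
have lf : linear f.
  move=> c x y; apply: graph_uniq (fP _) _; rewrite !LscaleDl !LscaleZl addrACA.
  by rewrite -scalerDr memvD // memvZ.
have [a aE] := linear_lin_poly cop lf.
by exists a => x; rewrite -aE.
Qed.

End Graph.
End Space.

(** * Coordinates in a frame v0, v1, w *)

Section Frame.
Variables (F : finFieldType) (L : fieldExtType F) (r m : nat).
Local Notation V := (Vr L r).
Local Notation n := (\dim {:L}).
Local Notation q := #|F|.
Variables (v0 v1 : V) (w : 'I_m -> V).

Definition frame_comb (x y : L) (z : 'I_m -> L) : V :=
  Lscale x v0 + Lscale y v1 + Lcomb z w.

Hypothesis frame_gen : forall v, exists x y z, v = frame_comb x y z.
Hypothesis frame_free : forall x y z, frame_comb x y z = 0 ->
  [/\ x = 0, y = 0 & forall k, z k = 0].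

Lemma eq_Lcomb (z z' : 'I_m -> L) (b : 'I_m -> V) : z =1 z' -> Lcomb z b = Lcomb z' b.
Proof. by move=> zz'; apply: eq_bigr => k _; rewrite zz'. Qed.

Lemma Lcomb0 (b : 'I_m -> V) : Lcomb (fun=> 0) b = 0.
Proof. by apply: big1 => k _; rewrite Lscale0l. Qed.

Lemma frame_comb0 x y : frame_comb x y (fun=> 0) = Lscale x v0 + Lscale y v1.
Proof. by rewrite /frame_comb Lcomb0 addr0. Qed.

Lemma frame_combD x y z x' y' z' :
  frame_comb x y z + frame_comb x' y' z' =
  frame_comb (x + x') (y + y') (fun k => z k + z' k).
Proof.
rewrite /frame_comb !LscaleDl addrACA; congr (_ + _); first by rewrite addrACA.
by rewrite -big_split; apply: eq_bigr => k _; rewrite /= LscaleDl.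
Qed.

Lemma frame_combZ t x y z :
  Lscale t (frame_comb x y z) = frame_comb (t * x) (t * y) (fun k => t * z k).
Proof.
rewrite /frame_comb !LscaleDr !LscaleA; congr (_ + _).
by rewrite /Lcomb Lscale_sumr; apply: eq_bigr => k _; rewrite LscaleA.
Qed.

Lemma frame_combE x y z : frame_comb x y z = frame_comb x 0 z + Lscale y v1.
Proof. by rewrite /frame_comb Lscale0l addr0 addrAC. Qed.

Lemma frame_comb_inj x y z x' y' z' : frame_comb x y z = frame_comb x' y' z' ->
  [/\ x = x', y = y' & z =1 z'].
Proof.
move=> E; have : frame_comb (x - x') (y - y') (fun k => z k - z' k) = 0.
  apply/eqP; rewrite -(inj_eq (addIr (frame_comb x' y' z'))) frame_combD add0r -E.
  by rewrite !subrK /frame_comb (eq_Lcomb _ (z' := z)) // => k; rewrite subrK.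
case/frame_free => /eqP; rewrite subr_eq0 => /eqP-> /eqP; rewrite subr_eq0 => /eqP->.
by move=> zz'; split=> // k; apply/eqP; rewrite -subr_eq0 zz'.
Qed.

Lemma graph_mem (X : {vspace V}) (f0 : L -> L) (f : 'I_m -> L -> L) :
  (forall y, Lscale y v1 \in X -> y = 0) ->
  (forall x, Lscale x v0 + Lscale (f0 x) v1 \in X) ->
  (forall k x, Lscale x (w k) + Lscale (f k x) v1 \in X) ->
  forall x y z, frame_comb x y z \in X <-> y = f0 x + \sum_k f k (z k).
Proof.
move=> X1 X0 Xk x y z.
have Xf : frame_comb x (f0 x + \sum_k f k (z k)) z \in X.
  have -> : frame_comb x (f0 x + \sum_k f k (z k)) z =
      (Lscale x v0 + Lscale (f0 x) v1) +
      \sum_k (Lscale (z k) (w k) + Lscale (f k (z k)) v1).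
    by rewrite big_split -Lscale_suml /frame_comb /= LscaleDl -!addrA [Lcomb z w + _]addrC.
  by rewrite memvD // memv_suml.
split=> [Xy|-> //].
by apply: (graph_uniq X1 (v := frame_comb x 0 z)); rewrite -frame_combE.
Qed.

(** [LinSet] extended to the zero vector, which satisfies it for every X; the slope condition at x =
    0, z = 0 is then covered as well. *)
Definition in_Lmult (X : {vspace V}) (v : V) := exists2 t, t != 0 & Lscale t v \in X.

Lemma in_Lmult_eq (U W : {vspace V}) :
  PSetEq (LinSet (inVS U)) (LinSet (inVS W)) -> forall v, in_Lmult U v <-> in_Lmult W v.
Proof.
move=> UW v; have [->|v0'] := eqVneq v 0.
  by split=> _; exists 1; rewrite ?oner_neq0 // Lscale0r mem0v.
split=> -[t t0 Ht].
  have [[_ [l [l0 Hl]]] _] : LinSet (inVS W) v /\ True.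
    by split=> //; apply/UW; split; [apply/eqP|exists t].
  by exists l.
have [[_ [l [l0 Hl]]] _] : LinSet (inVS U) v /\ True.
  by split=> //; apply/UW; split; [apply/eqP|exists t].
by exists l.
Qed.

Lemma slopes_in_Lmult (X : {vspace V}) (f : L -> ('I_m -> L) -> L) :
  (forall x y z, frame_comb x y z \in X <-> y = f x z) ->
  forall x z v, (exists2 t, t != 0 & f (t * x) (fun k => t * z k) = t * v) <->
    in_Lmult X (frame_comb x v z).
Proof.
move=> XE x z v; split=> -[t t0 H]; exists t => //.
  by rewrite frame_combZ; apply/XE.
by move: H; rewrite frame_combZ => /XE.
Qed.

Lemma graph_scale (U W : {vspace V}) (fU fW : L -> ('I_m -> L) -> L) (lambda : L) :
  (forall x z z', z =1 z' -> fW x z = fW x z') -> lambda != 0 ->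
  (forall x y z, frame_comb x y z \in U <-> y = fU x z) ->
  (forall x y z, frame_comb x y z \in W <-> y = fW x z) ->
  (forall x z, fW (lambda * x) (fun k => lambda * z k) = lambda * fU x z) ->
  forall v, v \in W <-> exists2 u, u \in U & v = Lscale lambda u.
Proof.
move=> ext l0 UE WE fUW v; split=> [|[u]].
  have [x [y [z ->]]] := frame_gen v => /WE yE.
  exists (frame_comb (lambda^-1 * x) (lambda^-1 * y) (fun k => lambda^-1 * z k)).
    apply/UE; apply: (mulfI l0); rewrite -fUW !mulVKf // yE.
    by apply: ext => k; rewrite mulVKf.
  rewrite frame_combZ !mulVKf // /frame_comb; congr (_ + _).
  by apply: eq_Lcomb => k; rewrite mulVKf.
have [x [y [z ->]]] := frame_gen u => /UE -> ->.
by rewrite frame_combZ; apply/WE.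
Qed.

(** On the L-span of the [b k] the argument of the power vanishes and y is the linear part, so this
    span lies in U. Modulo it every vector of U is a vector of U in T, which makes the linear set a
    cone. *)
Lemma graph_cone_set (U T : {vspace V}) (alpha : L) (e : nat) (eta beta : 'I_m -> L) :
  alpha != 0 -> LsubspaceDim T 2 -> v0 \in T -> v1 \in T ->
  (forall v, v \in T -> exists x y, v = Lscale x v0 + Lscale y v1) ->
  (forall x y z, frame_comb x y z \in U <-> y =
     alpha * (x + \sum_k eta k * z k) ^+ (q ^ e) + \sum_k beta k * z k) ->
  exists Lam : {vspace V}, LsubspaceDim Lam m /\ (Lam :&: T)%VS = 0%VS /\
    PSetEq (LinSet (inVS U)) (Cone Lam (LinSet (inVS (U :&: T)%VS))).
Proof.
move=> alpha0 dT v0T v1T Tgen UE.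
pose b k := w k + Lscale (- eta k) v0 + Lscale (beta k) v1.
have bE c : Lcomb c b =
    frame_comb (- \sum_k eta k * c k) (\sum_k beta k * c k) c.
  rewrite /frame_comb -sumrN !Lscale_suml /Lcomb -!big_split; apply: eq_bigr => k _ /=.
  by rewrite !LscaleDr !LscaleA mulrN [c k * eta k]mulrC [c k * beta k]mulrC -[LHS]addrA [LHS]addrC.
have [Lam LamE] := Lspan_exists b.
have dLam : LsubspaceDim Lam m.
  by exists b; split=> // c; rewrite bE => /frame_free[].
have q0 : (0 < q ^ e)%N by rewrite expn_gt0 (ltnW (finNzRing_gt1 F)).
have LamU v : v \in Lam -> v \in U.
  move=> /LamE[c ->]; rewrite bE; apply/UE.
  by rewrite addNr expr0n gtn_eqF // mulr0 add0r.
exists Lam; split=> //; split.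
  apply/eqP; rewrite -subv0; apply/subvP => v; rewrite memv_cap => /andP[/LamE[c ->]].
  rewrite bE => /Tgen[x [y H]].
  have /frame_comb_inj[_ _ c0] : frame_comb (- \sum_k eta k * c k) (\sum_k beta k * c k) c
      = frame_comb x y (fun=> 0) by rewrite H frame_comb0.
  by rewrite -bE (eq_Lcomb _ c0) Lcomb0 mem0v.
have memT x y : Lscale x v0 + Lscale y v1 \in T.
  by rewrite memvD // (LsubspaceDim_scale _ dT).
have p0P x : Lscale x v0 + Lscale (alpha * x ^+ (q ^ e)) v1 \in (U :&: T)%VS.
  rewrite memv_cap memT andbT.
  rewrite -frame_comb0; apply/UE.
  by rewrite !big1 ?addr0 // => k _; exact: mulr0.
have p0L x : x != 0 ->
    LinSet (inVS (U :&: T)%VS) (Lscale x v0 + Lscale (alpha * x ^+ (q ^ e)) v1).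
  move=> x0; split; last by exists 1; rewrite oner_neq0 Lscale1; split=> //; exact: p0P.
  move=> H; case/eqP: x0.
  by move: H; rewrite -frame_comb0 => /frame_free[].
move=> v; split=> [[vn0 [l [l0 lv]]]|[vn0 [p [u [l [[_ [mu [mu0 Hp]]] [uL vE]]]]]]].
  split=> //; have [x [y [z E]]] := frame_gen (Lscale l v).
  move: lv; rewrite /inVS E => /UE yE.
  set x' := x + \sum_k eta k * z k in yE.
  have {}E : v = Lscale l^-1 (Lcomb z b) +
      Lscale l^-1 (Lscale x' v0 + Lscale (alpha * x' ^+ (q ^ e)) v1).
    apply: (LscaleI l0); rewrite LscaleDr !LscaleA mulfV // !Lscale1 E bE.
    have xE : - \sum_k eta k * z k + x' = x by rewrite /x' addrCA addNr addr0.
    rewrite -frame_comb0 frame_combD xE yE [_ + alpha * _]addrC /frame_comb.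
    by congr (_ + _); apply: eq_Lcomb => k; rewrite addr0.
  have uL : Lscale l^-1 (Lcomb z b) \in Lam.
    by apply: (LsubspaceDim_scale _ dLam); apply/LamE; exists z.
  (* If x' = 0 the point lies in the vertex; a base point must still be named, and it enters with
     scalar 0. *)
  have [x0|x0] := eqVneq x' 0.
    exists (Lscale 1 v0 + Lscale (alpha * 1 ^+ (q ^ e)) v1), (Lscale l^-1 (Lcomb z b)), 0.
    split; first exact: p0L (oner_neq0 _).
    split=> //; rewrite Lscale0l E x0 expr0n gtn_eqF // mulr0 !Lscale0l.
    by rewrite !addr0 Lscale0r addr0.
  by do 3 eexists; split; [exact: p0L x0|split; [exact: uL|exact: E]].
split=> //; have [l0|l0] := eqVneq l 0.
  exists 1; rewrite oner_neq0 Lscale1; split=> //.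
  by rewrite /inVS vE l0 Lscale0l addr0 LamU.
exists (mu / l); split; first by rewrite mulf_neq0 ?invr_neq0.
rewrite /inVS vE LscaleDr LscaleA divfK // memvD //.
  by apply: LamU; apply: (LsubspaceDim_scale _ dLam).
by move: Hp; rewrite /inVS memv_cap => /andP[].
Qed.

End Frame.

Theorem mainTheorem18 (F : finFieldType) (L : fieldExtType F) (r : nat)
  (U W T : {vspace Vr L r}) :
  (3 <= r)%N ->
  \dim U = ((r - 1) * \dim {:L})%N ->
  \dim W = ((r - 1) * \dim {:L})%N ->
  PSetEq (LinSet (inVS U)) (LinSet (inVS W)) ->
  LsubspaceDim T 2 ->
  \dim (U :&: T)%VS = \dim {:L} ->
  \dim (W :&: T)%VS = \dim {:L} ->
  PSetEq (LinSet (inVS (U :&: T)%VS)) (LinSet (inVS (W :&: T)%VS)) ->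
  pseudoregulusType T (LinSet (inVS (U :&: T)%VS)) ->
  maxFieldLinearity_q (LinSet (inVS (U :&: T)%VS)) ->
  (exists lambda : L, lambda != 0 /\
      forall v, v \in W <-> exists2 u, u \in U & v = Lscale lambda u)
  \/
  (exists Lam : {vspace Vr L r},
      LsubspaceDim Lam (r - 2) /\ (Lam :&: T)%VS = 0%VS /\
      PSetEq (LinSet (inVS U)) (Cone Lam (LinSet (inVS (U :&: T)%VS)))).
Proof.
move=> r3 dU dW LUW dT _ _ LUW0 [i [v0 [v1 [v0T [v1T [ind P]]]]]] maxF.
set n := \dim {:L} in dU dW *; pose q := #|F|.
have n0 := ext_dim_gt0 L; have cK := ext_card L; have qc := ext_char L.
have cop := maxField_coprime P maxF.
have r0 : (0 < r)%N by apply: leq_trans r3.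
have combE (c : 'I_2 -> L) : Lcomb c [ffun j : 'I_2 => if j == ord0 then v0 else v1]
    = Lscale (c ord0) v0 + Lscale (c ord_max) v1.
  rewrite /Lcomb big_ord_recl big_ord1 !ffunE /=.
  by congr (_ + Lscale (c _) _); apply: val_inj.
have ind' x y : Lscale x v0 + Lscale y v1 = 0 -> x = 0 /\ y = 0.
  move=> xy; have H := ind (fun j => if j == ord0 then x else y).
  rewrite combE /= in H.
  by split; [exact: (H xy ord0)|exact: (H xy ord_max)].
have Tgen v : v \in T -> exists x y, v = Lscale x v0 + Lscale y v1.
  have [S SE] := Lspan_exists [ffun j : 'I_2 => if j == ord0 then v0 else v1].
  have dS : LsubspaceDim S 2 by exists [ffun j : 'I_2 => if j == ord0 then v0 else v1].
  have ST : (S <= T)%VS.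
    apply/subvP => u /SE[c ->]; rewrite combE.
    by rewrite memvD // (LsubspaceDim_scale _ dT).
  have /eqP <- : S == T.
    by rewrite eqEdim ST (LsubspaceDim_dim dS) (LsubspaceDim_dim dT) leqnn.
  by move=> /SE[c ->]; rewrite combE; exists (c ord0), (c ord_max).
have qi0 j : 0 ^+ (#|F| ^ j) = 0 :> L.
  by rewrite expr0n gtn_eqF // expn_gt0 (ltnW (finNzRing_gt1 F)).
(* A vector of the pseudoregulus form proportional to v1 needs mu = 0, hence is zero. *)
have v1P : ~ LinSet (inVS (U :&: T)%VS) v1.
  move=> /P[_ [l [l0 [mu /esym E]]]]; case/eqP: l0.
  have [mu0] : mu = 0 /\ mu ^+ (#|F| ^ i) - l = 0.
    by apply: ind'; rewrite LscaleDl addrA E LscaleNl subrr.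
  by rewrite mu0 qi0 sub0r => /eqP; rewrite oppr_eq0 => /eqP.
have v1n : v1 <> 0.
  move=> z; case: (ind' 0 1); rewrite ?z ?Lscale0r ?addr0 ?Lscale0l // => _ /eqP.
  by rewrite oner_eq0.
have X1 (X : {vspace Vr L r}) :
    PSetEq (LinSet (inVS (U :&: T)%VS)) (LinSet (inVS (X :&: T)%VS)) ->
    forall y, Lscale y v1 \in X -> y = 0.
  move=> UX y yX; apply/eqP; apply: contraT => y0; case: v1P; apply/UX.
  split=> //; exists y; split=> //.
  by rewrite /inVS memv_cap yX (LsubspaceDim_scale _ dT).
have U1 := X1 U (fun v => iff_refl _); have W1 := X1 W LUW0.
have Utot := graph_total U1 r0 dU; have Wtot := graph_total W1 r0 dW.
have [a0 a0P] := graph_coord U1 cop Utot v0.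
have memT x y : Lscale x v0 + Lscale y v1 \in T.
  by rewrite memvD // (LsubspaceDim_scale _ dT).
have n1 := ltn_pmod 1 n0.
(* Both sides list the points <(1, v)> of the same linear set, through U itself and through the
   pseudoregulus form. These may be different subspaces, so the monomial shape of [a0] has to be
   deduced. *)
have slopes0 : same_slopes n (q ^ i) a0 (fun l => if l == (1 %% n)%N then 1 else 0).
  have deltaE (t : L) : lin_poly n (q ^ i) (fun l => if l == (1 %% n)%N then 1 else 0) t
      = t ^+ (q ^ i).
    rewrite (@lin_poly_delta (FinFieldExtType L) q n i _ 1 t n1) mul1r.
    by rewrite (@frob_mod (FinFieldExtType L) q n i cK 1 t) expn1.
  have vn v : Lscale 1 v0 + Lscale v v1 <> 0.
    by case/ind' => /eqP; rewrite oner_eq0.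
  move=> v; have [PU UP] := P (Lscale 1 v0 + Lscale v v1); split=> -[t t0 Ht].
    have [|_ [l [l0 [mu E]]]] := PU.
      split; first exact: vn.
      exists t; split=> //; rewrite /inVS memv_cap LscaleDr !LscaleA mulr1 memT andbT.
      by rewrite -Ht a0P.
    exists l => //; rewrite deltaE.
    have [lmu vmu] : l - mu = 0 /\ l * v - mu ^+ (#|F| ^ i) = 0.
      apply: ind'; move: E; rewrite LscaleDr !LscaleA mulr1 !LscaleDl !LscaleNl addrACA => ->.
      by rewrite -opprD subrr.
    by have /eqP := lmu; have /eqP := vmu; rewrite !subr_eq0 => /eqP-> /eqP->.
  have [|_ [l [l0]]] := UP.
    split; first exact: vn.
    exists t; split=> //; exists t; rewrite LscaleDr !LscaleA mulr1 -Ht deltaE.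
    by [].
  rewrite /inVS memv_cap LscaleDr !LscaleA mulr1 => /andP[lU _].
  by exists l => //; exact: (graph_uniq U1 (a0P l) lU).
have [d [dn copd a0d a0z]] :=
  @same_slopes_monomial (FinFieldExtType L) q n i n0 cK qc cop a0 1 (oner_neq0 _) slopes0.
set alpha := a0 d in a0d.
(* Changing the base from q^i to q^e places the x-part of U at index 1 modulo n and keeps the
   exponent prime to n; all other coordinates are expanded in this base. *)
pose e := (i * d)%N; have cope : coprime e n by rewrite coprimeMl cop copd.
have a0E x : lin_poly n (q ^ i) a0 x = alpha * x ^+ (q ^ e).
  rewrite /e expnM -(@lin_poly_delta (FinFieldExtType L) q n i d alpha x dn).
  apply: eq_bigr => l _; case: eqP => [->|/eqP ld] //.
  by rewrite (a0z l (ltn_ord l) ld).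
have [m [w [rm gen free]]] := complete_basis ind'.
have [b0 b0P] := graph_coord W1 cope Wtot v0.
have [A AP] := fin_all_exists (fun k => graph_coord U1 cope Utot (w k)).
have [B BP] := fin_all_exists (fun k => graph_coord W1 cope Wtot (w k)).
have UE := graph_mem (f0 := fun x => alpha * x ^+ (q ^ e)) U1
  (fun x => eq_ind _ (fun y => Lscale x v0 + Lscale y v1 \in U) (a0P x) _ (a0E x)) AP.
have WE := graph_mem W1 b0P BP.
have slopesUW x z v := iff_trans (slopes_in_Lmult UE x z v)
  (iff_trans (in_Lmult_eq LUW _) (iff_sym (slopes_in_Lmult WE x z v))).
have [[lambda l0 lE]|[eta [beta fE]]] := @graph_dichotomy (FinFieldExtType L) q n e
  n0 cK qc cope m alpha A B b0 a0d slopesUW.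
  left; exists lambda; split=> //; apply: (graph_scale gen _ l0 UE WE lE).
  by move=> x z z' zz'; congr (_ + _); apply: eq_bigr => k _; rewrite zz'.
right; have -> : (r - 2 = m)%N by rewrite rm subn2.
apply: (@graph_cone_set F L r m v0 v1 w gen free U T alpha e eta beta) => //.
by move=> x y z; rewrite -[X in _ = X]fE; exact: UE.
Qed.
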